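(* Let $\rho>0$, $\sigma^2>0$, let $\mathbf g\in\mathbb C^{M_R}$, $\mathbf h\in\mathbb C^{M_T}$ have unit-modulus entries, $\mathbf H=\mathbf g\mathbf h^T$, let $\mathbf\Phi\in\mathbb R^{M_R\times M_T}$ with $\mathrm{vec}(\mathbf\Phi)\sim\mathcal N(\mathbf 0,\sigma^2\mathbf I_{M_TM_R})$, $\hat{\mathbf H}=\mathbf H\circ(\mathbf 1+j\mathbf\Phi)$ and $\hat C=\mathbb E\{\log_2\det(\mathbf I_{M_R}+\frac{\rho}{M_T}\hat{\mathbf H}\hat{\mathbf H}^H)\}$. If $M_R\le M_T$ then $$\hat C\ge\log_2\Big(1+\sum_{n=1}^{M_R}\Big(\frac{\rho}{M_T}\Big)^n\binom{M_R}{n}\prod_{i=0}^{n-1}\Big(\delta_i\,nM_T+2\sigma^2e^{\psi\left(\frac{M_T-i}{2}\right)}\Big)\Big),$$ and if $M_R>M_T$ then $$\hat C\ge\log_2\Big(1+\sum_{n=1}^{M_T}\Big(\frac{\rho}{M_T}\Big)^n\binom{M_T}{n}\prod_{i=0}^{n-1}\Big(\delta_i\,nM_R+2\sigma^2e^{\psi\left(\frac{M_R-i}{2}\right)}\Big)\Big).$$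
   Context: $\circ$ is the Hadamard product, $\mathbf 1$ the all-ones matrix, $\delta_i=1$ if $i=0$ and $0$ otherwise, $\psi(z)=\Gamma'(z)/\Gamma(z)$ is the digamma function. *)

(* Defs.v *)
From HB Require Import structures.
From mathcomp Require Import all_boot all_order all_algebra.
From mathcomp Require Import all_classical all_reals all_analysis.
From mathcomp Require Import complex.
Set Implicit Arguments. Unset Strict Implicit. Unset Printing Implicit Defensive.
Import Order.TTheory GRing.Theory Num.Theory.
Local Open Scope classical_set_scope.
Local Open Scope ring_scope.

Definition log2 {R : realType} (x : R) : R := ln x / ln 2.

Definition Gamma {R : realType} (x : R) : R :=
  fine (\int[@lebesgue_measure R]_(t in [set t : R | (0 < t)%R]) (powR t (x - 1) * expR (- t))%R%:E)%E.

Definition digamma {R : realType} (x : R) : R := (derive1 (@Gamma R) x) / Gamma x.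

Definition kdelta {R : realType} (i : nat) : R := (i == 0%N)%:R.

Definition ctrmx {R : rcfType} m n (A : 'M[R[i]]_(m, n)) : 'M[R[i]]_(n, m) :=
  \matrix_(k, l) (A l k)^*.

Definition hadamard {K : Type} (mul : K -> K -> K) m n (A B : 'M[K]_(m, n)) :
  'M[K]_(m, n) := \matrix_(k, l) mul (A k l) (B k l).

Definition mutually_independent {d} {T : measurableType d} {R : realType}
  (P : probability T R) (I : finType) (X : I -> T -> R) : Prop :=
  forall B : I -> set R, (forall k, measurable (B k)) ->
    P (\bigcap_(k in [set: I]) (X k @^-1` B k)) =
    (\prod_(k : I) P (X k @^-1` B k))%E.

Definition Hhat {R : rcfType} MR MT (g : 'cV[R[i]]_MR) (h : 'cV[R[i]]_MT)
  (Phi : 'M[R]_(MR, MT)) : 'M[R[i]]_(MR, MT) :=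
  hadamard *%R (g *m h^T) (\matrix_(k, l) (1 + (Complex 0 1) * (Phi k l)%:C)%C).

(* log2 det (I + rho/MT Hhat Hhat^H) (the determinant is real positive) *)
Definition capa {R : realType} MR MT (rho : R) (g : 'cV[R[i]]_MR)
  (h : 'cV[R[i]]_MT) (Phi : 'M[R]_(MR, MT)) : R :=
  log2 (complex.Re (\det (1%:M + ((rho / MT%:R)%:C)%C *: (Hhat g h Phi *m ctrmx (Hhat g h Phi))))).

(* the lower bound, with m = min(MR,MT), M = max(MR,MT) *)
Definition capa_lb {R : realType} (rho sigma2 : R) (MT m M : nat) : R :=
  log2 (1 + \sum_(1 <= n < m.+1)
    (rho / MT%:R) ^+ n * 'C(m, n)%:R *
    \prod_(0 <= k < n) (kdelta k * (n * M)%:R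
                        + 2 * sigma2 * expR (digamma ((M%:R - k%:R) / 2)))).

(* Main.v *)
(** The diagonal unitary matrices of [g] and [h] disappear from the determinant,
so [H] may be taken to be the all-ones matrix, and for [MR > MT] Sylvester's
identity exchanges the two dimensions. Expand [det (1 + c A A^H)],
[A = 1 + j Phi], over the principal minors of [A A^H]. For a set [S] of [n]
rows, rotations carrying the all-ones vectors to the first axes give
[det (A_S A_S^H) = det (Phi_S Phi_S^T) + n M det (N N^T)], where [N] is the
rotated [Phi_S] without its first row and column; hence the determinant is
[1 + sum_j p_j Y_j] for Gaussian Gram determinants [Y_j].

Since [x |-> ln (1 + sum_j p_j e^(x_j))] is convex, Jensen's inequality reduces
the claim to [E ln Y_j]. It is read off the negative moments
[E Y^(-a) = 1 - a E ln Y + o(a)], computed through the nonnegative integral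
[int_0^oo t^(a-1) e^(-tY) dt = Gamma(a) Y^(-a)], which has the right value
[+oo] at [Y = 0]; thus Tonelli applies everywhere and neither [Y > 0] almost
surely nor the integrability of [ln Y] has to be established. By rotation
invariance of iid Gaussian families, rotating the first row onto an axis splits
off from the Gram determinant an independent chi-square factor, so the negative
moments are products of ratios of Gamma values; their logarithmic derivatives at
[a = 0] are the digamma values of the bound. *)

Require Import Defs.
From HB Require Import structures.
From mathcomp Require Import all_boot all_order all_algebra.
From mathcomp Require Import all_classical all_reals all_analysis.
From mathcomp Require Import measurable_realfun complex ring lra.
Set Implicit Arguments.
Unset Strict Implicit.
Unset Printing Implicit Defensive.
Import Order.TTheory GRing.Theory Num.Theory.
Import numFieldNormedType.Exports.
Local Open Scope classical_set_scope.
Local Open Scope ring_scope.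

(** The product form of the bound comes from shared factors. The Gram determinant of an n by M
    Gaussian block has chi-square factors with M, M - 1, ..., M - n + 1 degrees of freedom; the
    block stripped of one row and one column has those with M - 1, ..., M - n + 1. Writing q_i for
    the exponential of the mean logarithm of factor i, the two summands of a minor contribute q_0
    q_1 ... q_(n-1) + n M q_1 ... q_(n-1), where only the factor i = 0 is altered: this is the term
    [kdelta k * (n * M)%:R]. The Y_j share entries and are dependent, but convexity enters as a
    tangent-plane inequality, linear in the ln Y_j, so only the law of each single Y_j matters. It
    needs E ln Y_j bounded from below only, hence the one-sided estimate Y^(-a) >= 1 - a ln Y. The
    moment of order -a of a chi-square variable with r degrees of freedom is finite for a < r / 2.
    Since n <= M, the smallest r is at least 1, whence the range 0 < a < 1/2. *)

Section algebra.
Variable K : comNzRingType.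

(** * Determinant identities over a commutative ring *)

Lemma det_1D_mulmxC m n (A : 'M[K]_(m, n)) (B : 'M[K]_(n, m)) :
  \det (1%:M + A *m B) = \det (1%:M + B *m A).
Proof.
pose X : 'M[K]_(m + n) := block_mx 1%:M (- A) B 1%:M.
pose U : 'M[K]_(m + n) := block_mx 1%:M A 0 1%:M.
have dU : \det U = 1 by rewrite /U det_ublock !det1 mulr1.
have E1 : \det (U *m X) = \det (1%:M + A *m B).
  rewrite /U /X mulmx_block !mul1mx !mul0mx !mulmx1 !add0r addNr.
  by rewrite det_lblock det1 mulr1.
have E2 : \det (X *m U) = \det (1%:M + B *m A).
  rewrite /U /X mulmx_block !mul1mx !mulmx1 !mulmx0 !addr0 subrr [_ + 1%:M]addrC.
  by rewrite det_lblock det1 mul1r.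
by rewrite -E1 -E2 !det_mulmx mulrC.
Qed.

(** Every row of [1%:M + X] is a row of [X] plus a row of the identity, so multilinearity gives one
    term per set [S] of rows taken from [X]. That term is the identity plus a product through
    dimension [#|S|], which Sylvester's identity shrinks to the minor. *)
Lemma det_1D_minors m (X : 'M[K]_m) :
  \det (1%:M + X) = \sum_(S : {set 'I_m})
    \det (mxsub (@enum_val _ (mem S)) (@enum_val _ (mem S)) X).
Proof.
pose MS (S : {set 'I_m}) := \matrix_(i, j) (if i \in S then X i j else (i == j)%:R) : 'M[K]_m.
have -> : \det (1%:M + X) = \sum_(S : {set 'I_m}) \det (MS S).
  rewrite /determinant exchange_big /=; apply: eq_bigr => s _.
  rewrite -big_distrr /=; congr (_ * _).
  under eq_bigr do rewrite !mxE addrC.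
  rewrite bigA_distr; apply: eq_bigr => S _; apply: eq_bigr => i _.
  by rewrite !mxE.
apply: eq_bigr => S _.
pose E : 'M[K]_(#|S|, m) := \matrix_(k, i) (enum_val k == i)%:R.
have EX (Y : 'M[K]_m) : E *m Y = rowsub (@enum_val _ (mem S)) Y.
  apply/matrixP => i j; rewrite !mxE (bigD1 (enum_val i)) //= mxE eqxx mul1r.
  rewrite big1 ?addr0 // => k ki; rewrite mxE eq_sym (negbTE ki) mul0r //.
have ET n (Y : 'M[K]_(n, m)) : Y *m E^T = colsub (@enum_val _ (mem S)) Y.
  apply/matrixP => i j; rewrite !mxE (bigD1 (enum_val j)) //= !mxE eqxx mulr1.
  rewrite big1 ?addr0 // => k ki; rewrite !mxE eq_sym (negbTE ki) mulr0 //.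
have EE : E *m E^T = 1%:M.
  apply/matrixP => i j; rewrite ET !mxE; congr (_%:R).
  by rewrite (inj_eq enum_val_inj).
(* [E] selects the coordinates in [S], so [E^T *m E] projects onto them: adding the projection of
   [X - 1%:M] replaces exactly the rows in [S]. *)
have -> : MS S = 1%:M + E^T *m (E *m (X - 1%:M)).
  apply/matrixP => i j; rewrite !mxE.
  under eq_bigr => k _ do rewrite EX !mxE.
  case: ifPn => iS.
    rewrite (bigD1 (enum_rank_in iS i)) //= enum_rankK_in// eqxx mul1r.
    rewrite big1 ?addr0 => [|k ki]; first by rewrite addrC subrK.
    case: eqP => [ek|_]; last by rewrite mul0r.
    by case/eqP: ki; apply: enum_val_inj; rewrite enum_rankK_in.
  rewrite big1 ?addr0 // => k _; case: eqP => [ek|_]; last by rewrite mul0r.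
  by case/negP: iS; rewrite -ek enum_valP.
rewrite det_1D_mulmxC -mulmxA mulmxBl mul1mx mulmxBr EE addrC subrK mulmxA EX ET.
by congr (\det _); apply/matrixP => i j; rewrite !mxE.
Qed.

Lemma det_block_rowD n k a1 a2 (r1 r2 : 'rV[K]_n) (c : 'cV[K]_n) (N : 'M[K]_n) :
  \det (block_mx (k * a1 + a2)%:M (k *: r1 + r2) c N) =
  k * \det (block_mx a1%:M r1 c N) + \det (block_mx a2%:M r2 c N).
Proof.
rewrite -[\det (block_mx a2%:M _ _ _)]mul1r.
apply: (@determinant_multilinear _ _ _ _ _ (lshift n ord0)).
- apply/rowP => j; rewrite !mxE; case: splitP => [i0 _|//].
  rewrite !ord1 !mxE; case: splitP => l _; rewrite !mxE ?ord1 ?mulr1n ?mul1r//.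
- apply/matrixP => i j; rewrite !mxE; case: splitP => [l e|l _]; last by rewrite !mxE.
  by have := ltn_ord l; rewrite -e /= /bump.
- apply/matrixP => i j; rewrite !mxE; case: splitP => [l e|l _]; last by rewrite !mxE.
  by have := ltn_ord l; rewrite -e /= /bump.
Qed.

Lemma det_block_colD n k a1 a2 (r : 'rV[K]_n) (c1 c2 : 'cV[K]_n) (N : 'M[K]_n) :
  \det (block_mx (k * a1 + a2)%:M r (k *: c1 + c2) N) =
  k * \det (block_mx a1%:M r c1 N) + \det (block_mx a2%:M r c2 N).
Proof.
rewrite -det_tr tr_block_mx tr_scalar_mx linearP det_block_rowD.
by rewrite -[in RHS]det_tr tr_block_mx tr_scalar_mx -[in X in _ = _ + X]det_tr tr_block_mx tr_scalar_mx.
Qed.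

Lemma det_block_schur1 n (r : 'rV[K]_n) (c : 'cV[K]_n) (N : 'M[K]_n) :
  \det (block_mx 1%:M r c (c *m r + N)) = \det N.
Proof.
have -> : block_mx 1%:M r c (c *m r + N) = block_mx 1%:M 0 c 1%:M *m block_mx 1%:M r 0 N.
  by rewrite mulmx_block !mul1mx !mulmx1 !mul0mx !addr0.
by rewrite det_mulmx det_lblock det_ublock !det1 !mul1r.
Qed.

(* Without the coefficient of [u + v], the determinant of the product with corners
   [u] and [v] is affine in [u v]; with [w1, w2 = x -+ j z] the sums agree. *)
Lemma det_block_corner n M (f : 'rV[K]_M) (y : 'cV[K]_n) (N : 'M[K]_(n, M)) w1 w2 x :
  w1 + w2 = x + x ->
  \det (block_mx w1%:M f y N *m block_mx w2%:M y^T f^T N^T) =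
  \det (block_mx x%:M f y N *m block_mx x%:M y^T f^T N^T) +
  (w1 * w2 - x * x) * \det (N *m N^T).
Proof.
move=> wx.
pose p := (f *m f^T) 0 0; pose b := N *m f^T; pose G := y *m y^T + N *m N^T.
have GT : G^T = G by rewrite /G linearD /= !trmx_mul !trmxK.
have E u v : block_mx u%:M f y N *m block_mx v%:M y^T f^T N^T =
  block_mx (u * v + p)%:M (u *: y^T + b^T) (v *: y + b) G.
  rewrite mulmx_block mul_scalar_mx; congr block_mx.
  - by rewrite scale_scalar_mx [f *m _]mx11_scalar -/p raddfD.
  - by rewrite mul_scalar_mx trmx_mul trmxK.
  - by rewrite mul_mx_scalar.
(* The coefficient of [u * v] has corner 1, row [y^T] and column [y]; clearing them turns [G] into
   [N *m N^T]. The two mixed coefficients are transposes of each other, as [G] is symmetric. *)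
have D u v : \det (block_mx (u * v + p)%:M (u *: y^T + b^T) (v *: y + b) G) =
  u * v * \det (N *m N^T) + (u + v) * \det (block_mx 0%:M y^T b G)
  + \det (block_mx p%:M b^T b G).
  rewrite det_block_rowD.
  have := det_block_colD v 1 0 y^T y b G; rewrite mulr1 addr0 => ->.
  have := det_block_colD v 0 p b^T y b G; rewrite mulr0 add0r => ->.
  rewrite det_block_schur1 -[\det (block_mx 0%:M b^T y G)]det_tr tr_block_mx trmxK GT tr_scalar_mx.
  by ring.
rewrite !E !D wx; ring.
Qed.

(** Base times height: with the first row on an axis, the Gram determinant is its squared length
    times that of the other rows projected off this axis. *)
Lemma det_gram_lblock n M (z : K) (y : 'cV[K]_n) (N : 'M[K]_(n, M)) :
  \det (block_mx z%:M 0 y N *m (block_mx z%:M 0 y N)^T) = z ^+ 2 * \det (N *m N^T).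
Proof.
have -> : block_mx z%:M 0 y N *m (block_mx z%:M 0 y N)^T =
  block_mx z%:M 0 y 1%:M *m block_mx 1%:M 0 0 (N *m N^T) *m (block_mx z%:M 0 y 1%:M)^T.
  rewrite !tr_block_mx !mulmx_block !tr_scalar_mx !trmx0.
  by rewrite !(mul1mx, mulmx1, mul0mx, mulmx0, addr0, add0r).
rewrite !det_mulmx det_tr det_lblock det_ublock !det1 det_scalar1 !mulr1 !mul1r.
by rewrite mulrAC expr2.
Qed.

End algebra.

(** * Planar rotations, their products, and Gram determinants *)

Definition planar_rotation (K : pzRingType) m (i j : 'I_m) (c s : K) : 'M[K]_m :=
  \matrix_(k, l) (if l == i then c * (k == i)%:R - s * (k == j)%:R
                  else if l == j then s * (k == i)%:R + c * (k == j)%:R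
                  else (k == l)%:R).

Lemma mulmx_planar_rotation (K : comNzRingType) n m (A : 'M[K]_(n, m)) (i j : 'I_m) (c s : K) k l :
  i != j ->
  (A *m planar_rotation i j c s) k l =
  if l == i then c * A k i - s * A k j
  else if l == j then s * A k i + c * A k j else A k l.
Proof.
move=> ij.
have D (i0 : 'I_m) : \sum_p A k p * (p == i0)%:R = A k i0.
  rewrite (bigD1 i0) //= eqxx mulr1 big1 ?addr0 // => p /negbTE ->; exact: mulr0.
have [li|li] := boolP (l == i); last have [lj|lj] := boolP (l == j).
- rewrite mxE; under eq_bigr do rewrite mxE li mulrBr !(mulrCA (A _ _)).
  by rewrite sumrB -!mulr_sumr !D.
- rewrite mxE; under eq_bigr do rewrite mxE (negbTE li) lj mulrDr !(mulrCA (A _ _)).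
  by rewrite big_split /= -!mulr_sumr !D.
- by rewrite mxE; under eq_bigr do rewrite mxE (negbTE li) (negbTE lj); rewrite D.
Qed.

Lemma planar_rotation_orthogonal (K : comNzRingType) m (i j : 'I_m) (c s : K) :
  i != j -> c ^+ 2 + s ^+ 2 = 1 ->
  planar_rotation i j c s *m (planar_rotation i j c s)^T = 1%:M.
Proof.
move=> ij cs.
have ji : (j == i) = false by rewrite eq_sym (negbTE ij).
apply: mulmx1C; apply/matrixP => k l; rewrite mulmx_planar_rotation//.
rewrite !mxE !eqxx ji !(eq_sym i) ?(eq_sym j).
have [ki|ki] := boolP (k == i); have [li|li] := boolP (l == i);
  have [kj|kj] := boolP (k == j); have [lj|lj] := boolP (l == j);
  rewrite ?(eqP ki) ?(eqP li) ?(eqP kj) ?(eqP lj) ?ji ?eqxx ?(negbTE ij) ?(eq_sym i) ?ji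
   /= ?mulr1 ?mulr0 ?subr0 ?add0r ?addr0;
  try by move: ij; rewrite -?(eqP ki) -?(eqP kj) ?eqxx.
all: first [by rewrite -cs; ring | by ring | by rewrite (negbTE li) | by rewrite (negbTE ki)
  | by rewrite (negbTE lj) | by rewrite (negbTE kj) | by rewrite eq_sym
  | by rewrite eq_sym (negbTE li) | by rewrite eq_sym (negbTE ki)
  | by rewrite eq_sym (negbTE lj) | by rewrite eq_sym (negbTE kj)].
Qed.

(** Generated by planar rotations instead of being defined by orthogonality: invariance of Gaussian
    integrals then follows by induction from the two-variable case. *)
Inductive rotation (R : numDomainType) m : 'M[R]_m -> Prop :=
| rotation1 : rotation 1%:M
| rotationM Q i j c s : rotation Q -> i != j -> c ^+ 2 + s ^+ 2 = 1 -> -1 < c ->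
    rotation (Q *m planar_rotation i j c s).

Lemma rotation_orthogonal (R : numDomainType) m (Q : 'M[R]_m) :
  rotation Q -> Q *m Q^T = 1%:M.
Proof.
elim=> [|{}Q i j c s _ IH ij cs _]; first by rewrite trmx1 mulmx1.
by rewrite trmx_mul mulmxA -(mulmxA Q) planar_rotation_orthogonal// mulmx1.
Qed.

Lemma rotation_to_axis (R : rcfType) m (x : 'rV[R]_(1 + m)) :
  exists Q z, [/\ rotation Q, x *m Q = row_mx z%:M 0 & z ^+ 2 = \sum_l x 0 l ^+ 2].
Proof.
have H (s : seq 'I_(1 + m)) : 0 \notin s ->
    exists Q, rotation Q /\ forall l, l \in s -> (x *m Q) 0 l = 0.
  elim: s => [|l s IH] s0'; first by exists 1%:M; split => //; exact: rotation1.
  move: s0'; rewrite inE negb_or eq_sym => /andP[l0 s0].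
  have [Q [gQ sQ]] := IH s0.
  have [xl|xl] := eqVneq ((x *m Q) 0 l) 0.
    by exists Q; split => // k; rewrite inE => /orP[/eqP ->|/sQ].
  set p := (x *m Q) 0 0; set q := (x *m Q) 0 l in xl.
  have pq : 0 < p ^+ 2 + q ^+ 2.
    by rewrite ltr_wpDl ?sqr_ge0// exprn_even_gt0.
  pose r := Num.sqrt (p ^+ 2 + q ^+ 2).
  have r0 : 0 < r by rewrite sqrtr_gt0.
  have r2 : r ^+ 2 = p ^+ 2 + q ^+ 2 by rewrite sqr_sqrtr// ltW.
  have rn0 : r != 0 by rewrite gt_eqF.
  (* Givens rotation: the new entry [l] is (- q / r) p + (p / r) q = 0. Since q != 0, |p| < r, which
     gives -1 < c; the case q = 0 was set apart because p / r could then be -1. *)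
  exists (Q *m planar_rotation 0 l (p / r) (- q / r)); split.
    apply: rotationM => //; first by rewrite eq_sym.
      rewrite !expr_div_n -mulrDl sqrrN -r2 mulfV// expf_neq0//.
    rewrite ltr_pdivlMr// mulN1r ltrNl.
    apply: (le_lt_trans (ler_norm _)); rewrite normrN -sqrtr_sqr ltr_sqrt//.
    by rewrite ltrDl exprn_even_gt0.
  have l0' : 0 != l by rewrite eq_sym.
  move=> k; rewrite mulmxA mulmx_planar_rotation// -/p -/q inE.
  have [->|kl] := eqVneq k l.
    rewrite (negbTE l0) => _; field.
    by [].
  move=> /= ks; have [k0|k0] := eqVneq k 0; first by move: s0; rewrite -k0 ks.
  exact: sQ.
have [|Q [gQ sQ]] := H [seq i <- enum 'I_(1 + m) | i != 0].
  by rewrite mem_filter eqxx.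
have xQ : x *m Q = row_mx ((x *m Q) 0 0)%:M 0.
  apply/rowP => k; rewrite [RHS]mxE; case: splitP => [i ki|i ki].
    rewrite !ord1 [RHS]mxE mulr1n; congr ((x *m Q) _ _).
    by apply/val_inj; rewrite /= ki ord1.
  rewrite [RHS]mxE; apply: sQ; rewrite mem_filter mem_enum andbT.
  by apply/eqP => k0; move: ki; rewrite k0.
exists Q, ((x *m Q) 0 0); split => //.
have : (x *m Q) *m (x *m Q)^T = x *m x^T.
  by rewrite trmx_mul mulmxA -(mulmxA x) rotation_orthogonal// mulmx1.
rewrite {1 2}xQ tr_row_mx mul_row_col trmx0 mulmx0 addr0 tr_scalar_mx.
move=> /matrixP /(_ 0 0); rewrite -scalar_mxM !mxE mulr1n expr2 => ->.
by apply: eq_bigr => i _; rewrite !mxE expr2.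
Qed.

Lemma gram_rotation (R : numDomainType) n m (A : 'M[R]_(n, m)) Q : rotation Q ->
  (A *m Q) *m (A *m Q)^T = A *m A^T.
Proof. by move=> gQ; rewrite trmx_mul mulmxA -(mulmxA A) rotation_orthogonal// mulmx1. Qed.

Lemma det_gram_ge0 (R : rcfType) n m (A : 'M[R]_(n, m)) : 0 <= \det (A *m A^T).
Proof.
elim: n m A => [|n IH] m A; first by rewrite det_mx00 ler01.
case: m A => [|m] A.
  by rewrite (_ : A *m A^T = 0) ?det0//; apply/matrixP => i j; rewrite !mxE big_ord0.
have [Q [z [gQ xQ _]]] := rotation_to_axis (usubmx (A : 'M[R]_(1 + n, 1 + m))).
rewrite -(gram_rotation _ gQ).
pose B : 'M[R]_(1 + n, 1 + m) := A *m Q.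
have Eul : ulsubmx B = z%:M by rewrite /ulsubmx -mul_usub_mx xQ row_mxKl.
have Eur : ursubmx B = 0 by rewrite /ursubmx -mul_usub_mx xQ row_mxKr.
rewrite -[A *m Q]/B -(submxK B) Eul Eur.
by rewrite det_gram_lblock mulr_ge0 ?sqr_ge0.
Qed.

(** * The determinant of the perturbed all-ones matrix *)

Section complex_matrix.
Variable R : rcfType.
Local Notation C := R[i].
Local Notation toC := (real_complex R).

Lemma ctrmxE m n (A : 'M[C]_(m, n)) : ctrmx A = map_mx Num.conj A^T.
Proof. by apply/matrixP => i j; rewrite !mxE. Qed.

Lemma ctrmxM m n p (A : 'M[C]_(m, n)) (B : 'M[C]_(n, p)) :
  ctrmx (A *m B) = ctrmx B *m ctrmx A.
Proof. by rewrite !ctrmxE trmx_mul map_mxM. Qed.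

Lemma ctrmx_toC m n (A : 'M[R]_(m, n)) : ctrmx (map_mx toC A) = map_mx toC A^T.
Proof. by apply/matrixP => i j; rewrite !mxE; apply/eqP; rewrite eq_complex /= oppr0 !eqxx. Qed.

Definition perturbed m n (A : 'M[R]_(m, n)) : 'M[C]_(m, n) :=
  \matrix_(k, l) (1 + (Complex 0 1) * (A k l)%:C)%C.

Lemma perturbedE m n (A : 'M[R]_(m, n)) :
  perturbed A = map_mx toC (const_mx 1) + (Complex 0 1) *: map_mx toC A.
Proof. by apply/matrixP => i j; rewrite !mxE. Qed.

Lemma normC1_mulJ (z : C) : `|z| = 1 -> z^* * z = 1.
Proof. by move=> z1; rewrite mulrC -normCK z1 expr1n. Qed.

Lemma diag_mx_unitary m (g : 'cV[C]_m) : (forall k, `|g k 0| = 1) ->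
  ctrmx (diag_mx g^T) *m diag_mx g^T = 1%:M /\ diag_mx g^T *m ctrmx (diag_mx g^T) = 1%:M.
Proof.
move=> g1; have E : ctrmx (diag_mx g^T) *m diag_mx g^T = 1%:M.
  apply/matrixP => i j; rewrite mxE (bigD1 j)//= big1 => [|k kj].
    rewrite !mxE eqxx mulr1n addr0; have [_|_] := eqVneq i j.
      by rewrite mulr1n normC1_mulJ.
    by rewrite mulr0n rmorph0 mul0r.
  by rewrite !mxE (negbTE kj) mulr0n mulr0.
by split => //; exact: mulmx1C.
Qed.

Lemma HhatE m n (g : 'cV[C]_m) (h : 'cV[C]_n) (A : 'M[R]_(m, n)) :
  Hhat g h A = diag_mx g^T *m perturbed A *m diag_mx h^T.
Proof.
apply/matrixP => i j; rewrite mul_mx_diag mxE mul_diag_mx !mxE big_ord1 !mxE.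
by rewrite mulrAC mulrC mulrA.
Qed.

Lemma det_Hhat m n (g : 'cV[C]_m) (h : 'cV[C]_n) (A : 'M[R]_(m, n)) (c : C) :
  (forall k, `|g k 0| = 1) -> (forall l, `|h l 0| = 1) ->
  \det (1%:M + c *: (Hhat g h A *m ctrmx (Hhat g h A))) =
  \det (1%:M + c *: (perturbed A *m ctrmx (perturbed A))).
Proof.
move=> g1 h1; rewrite !HhatE !ctrmxM.
have [gl _] := diag_mx_unitary g1; have [_ hr] := diag_mx_unitary h1.
set G := diag_mx g^T in gl *; set H := diag_mx h^T in hr *; set B := perturbed A.
have -> : G *m B *m H *m (ctrmx H *m (ctrmx B *m ctrmx G)) =
   G *m (B *m ctrmx B *m ctrmx G).
  by rewrite !mulmxA -(mulmxA (G *m B) H) hr mulmx1.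
by rewrite scalemxAr det_1D_mulmxC -scalemxAl -(mulmxA _ (ctrmx G) G) gl mulmx1.
Qed.

Lemma det_perturbed_tr m n (A : 'M[R]_(m, n)) (c : C) :
  \det (1%:M + c *: (perturbed A *m ctrmx (perturbed A))) =
  \det (1%:M + c *: (perturbed A^T *m ctrmx (perturbed A^T))).
Proof.
rewrite scalemxAl det_1D_mulmxC -scalemxAr -det_tr linearD /= trmx1 linearZ /= trmx_mul.
congr (\det (_ + _ *: (_ *m _))).
  by apply/matrixP => i j; rewrite !mxE.
by apply/matrixP => i j; rewrite !mxE.
Qed.

(** Factoring [j] out of [B] leaves a real matrix except for the corner x - j z. In the conjugate
    transpose this corner becomes x + j z, and the two scalars j and -j cancel; the corners have sum
    2 x and product x^2 + z^2. *)
Lemma det_perturbed_corner m n (x : R) (f : 'rV[R]_n) (y : 'cV[R]_m) (N : 'M[R]_(m, n)) (z : R) :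
  let B : 'M[C]_(1 + m, 1 + n) := map_mx toC (block_mx z%:M 0 0 0) +
     Complex 0 1 *: map_mx toC (block_mx x%:M f y N) in
  \det (B *m ctrmx B) =
  toC (\det (block_mx x%:M f y N *m (block_mx x%:M f y N)^T) + z ^+ 2 * \det (N *m N^T)).
Proof.
move=> B; pose j : C := Complex 0 1.
have jj : j * j = -1.
  by apply/eqP; rewrite eq_complex /= !mul0r !mulr0 !mulr1 sub0r addr0 oppr0 !eqxx.
pose w1 : C := toC x - j * toC z; pose w2 : C := toC x + j * toC z.
pose fC := map_mx toC f; pose yC := map_mx toC y; pose NC := map_mx toC N.
have BE : B = j *: block_mx w1%:M fC yC NC.
  apply/matrixP => a b; rewrite /B !mxE.
  case: (fintype.split a) => a'; rewrite !mxE; case: (fintype.split b) => b'; rewrite !mxE ?rmorph0 ?add0r//.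
  rewrite !ord1 eqxx !mulr1n -[Complex 0 1]/j -!/(toC _) /w1 mulrBr mulrA jj mulN1r opprK.
  by rewrite addrC.
have cj t : (j * toC t)^* = - j * toC t.
  by apply/eqP; rewrite eq_complex /=; apply/andP; split; apply/eqP; ring.
have cr t : (toC t)^* = toC t.
  by apply/eqP; rewrite eq_complex /= ?oppr0 !eqxx.
have BHE : ctrmx B = (- j) *: block_mx w2%:M yC^T fC^T NC^T.
  apply/matrixP => a b; rewrite /B !mxE.
  case Ea: (fintype.split a) => [a'|a']; case Eb: (fintype.split b) => [b'|b'];
    rewrite ?(mxE, Ea, Eb) ?rmorph0 ?add0r ?cj//.
  rewrite !ord1 eqxx !mulr1n -[Complex 0 1]/j -!/(toC _) rmorphD /= cj cr /w2.
  by rewrite mulrDr [- j * (j * _)]mulrA [- j * j]mulNr jj opprK mul1r addrC.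
rewrite BHE BE -scalemxAl -scalemxAr scalerA mulrN jj opprK scale1r.
rewrite (@det_block_corner _ _ _ _ _ _ _ _ (toC x)); last by rewrite /w1 /w2; ring.
have -> : \det (block_mx (toC x)%:M fC yC NC *m block_mx (toC x)%:M yC^T fC^T NC^T) =
    toC (\det (block_mx x%:M f y N *m (block_mx x%:M f y N)^T)).
  rewrite -det_map_mx map_mxM; congr (\det (_ *m _)).
    by rewrite map_block_mx map_scalar_mx.
  by rewrite tr_block_mx map_block_mx tr_scalar_mx map_scalar_mx !map_trmx.
have -> : \det (NC *m NC^T) = toC (\det (N *m N^T)).
  by rewrite -det_map_mx map_mxM -map_trmx.
have -> : w1 * w2 - toC x * toC x = toC (z ^+ 2).
  have -> : w1 * w2 - toC x * toC x = - (j * j) * (toC z * toC z) by rewrite /w1 /w2; ring.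
  by rewrite jj opprK mul1r rmorphXn /= expr2.
by rewrite -rmorphM -rmorphD.
Qed.

(** The all-ones matrix is the outer product of all-ones vectors of squared lengths m + 1 and n + 1;
    with both on axes, only a corner entry of square (m + 1)(n + 1) is left. [P] and [Q] are chosen
    before [A], so that they can act on a random [A] as fixed rotations. *)
Lemma det_perturbed m n : exists P Q, [/\ rotation P, rotation Q &
  forall A : 'M[R]_(1 + m, 1 + n),
  let N := drsubmx (P^T *m A *m Q) in
  \det (perturbed A *m ctrmx (perturbed A)) =
  toC (\det (A *m A^T) + (m.+1 * n.+1)%:R * \det (N *m N^T))].
Proof.
have [P [z [gP xP z2]]] := rotation_to_axis (const_mx 1 : 'rV[R]_(1 + m)).
have [Q [z' [gQ xQ z'2]]] := rotation_to_axis (const_mx 1 : 'rV[R]_(1 + n)).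
exists P, Q; split => // A N.
have [PP QQ] := (rotation_orthogonal gP, rotation_orthogonal gQ).
have mapI p q r (U : 'M[R]_(p, q)) (V : 'M[R]_(q, r)) :
  map_mx toC (U *m V) = map_mx toC U *m map_mx toC V by exact: map_mxM.
pose L := map_mx toC P^T; pose W := map_mx toC Q.
have WW : W *m ctrmx W = 1%:M by rewrite /W ctrmx_toC -mapI QQ map_mx1.
have dL : \det L * \det (ctrmx L) = 1.
  by rewrite /L ctrmx_toC trmxK mulrC -det_mulmx -mapI PP map_mx1 det1.
have -> : \det (perturbed A *m ctrmx (perturbed A)) =
    \det ((L *m perturbed A *m W) *m ctrmx (L *m perturbed A *m W)).
  rewrite !ctrmxM !mulmxA -(mulmxA (L *m _) W) WW mulmx1.
  by rewrite det_mulmx -(mulmxA L) det_mulmx mulrAC dL mul1r.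
pose A' : 'M[R]_(1 + m, 1 + n) := P^T *m A *m Q.
have EA : L *m perturbed A *m W = map_mx toC (block_mx (z * z')%:M 0 0 0) +
   Complex 0 1 *: map_mx toC A'.
  rewrite perturbedE mulmxDr mulmxDl; congr (_ + _); last first.
    by rewrite -scalemxAr -scalemxAl /A' !mapI.
  rewrite -!mapI; congr map_mx.
  have -> : const_mx 1 = (const_mx 1 : 'rV[R]_(1 + m))^T *m (const_mx 1 : 'rV[R]_(1 + n)).
    by apply/matrixP => i j; rewrite !mxE big_ord1 !mxE mulr1.
  rewrite mulmxA -trmx_mul xP -mulmxA xQ tr_row_mx tr_scalar_mx trmx0 mul_col_row.
  by rewrite -scalar_mxM !mul0mx mulmx0.
have AE : block_mx ((ulsubmx A') 0 0)%:M (ursubmx A') (dlsubmx A') (drsubmx A') = A'.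
  by rewrite -mx11_scalar submxK.
rewrite EA -AE det_perturbed_corner AE; congr (toC (_ + _ * _)).
  rewrite /A' (gram_rotation _ gQ) trmx_mul trmxK.
  have -> : (P^T *m A) *m (A^T *m P) = P^T *m (A *m A^T) *m P by rewrite !mulmxA.
  by rewrite !det_mulmx mulrAC [\det P^T * _]mulrC -(det_mulmx P) PP det1 mul1r.
rewrite exprMn z2 z'2.
have E k : \sum_(l < 1 + k) (const_mx 1 : 'rV[R]_(1 + k)) 0 l ^+ 2 = k.+1%:R.
  by under eq_bigr do rewrite mxE expr1n; rewrite sumr_const card_ord.
by rewrite !E natrM.
Qed.

Lemma det_1D_perturbed m n (A : 'M[R]_(m, n)) (c : R) :
  \det (1%:M + toC c *: (perturbed A *m ctrmx (perturbed A))) =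
  \sum_(S : {set 'I_m}) toC c ^+ #|S| *
   \det (perturbed (rowsub (@enum_val _ (mem S)) A) *m
     ctrmx (perturbed (rowsub (@enum_val _ (mem S)) A))).
Proof.
rewrite det_1D_minors; apply: eq_bigr => S _; rewrite -detZ; congr (\det _).
apply/matrixP => i j; rewrite !mxE; congr (_ * _).
by apply: eq_bigr => k _; rewrite !mxE.
Qed.

End complex_matrix.

(** * Affine substitution and the integral that encodes negative powers *)

Lemma ge0_integral_lebesgue_affine {R : realType} (c b : R) (f : R -> \bar R) :
  0 < c -> measurable_fun setT f -> (forall x, (0 <= f x)%E) ->
  (c%:E * \int[lebesgue_measure]_x f (c * x + b)%R = \int[lebesgue_measure]_x f x)%E.
Proof.
move=> c0 mf f0.
pose phi : measurableTypeR R -> measurableTypeR R := fun x : R => c * x + b.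
have mphi : measurable_fun setT phi.
  apply: measurable_funD => //; exact: measurable_funM.
pose k : {nonneg R} := NngNum (ltW c0).
have E A : measurable A ->
   lebesgue_measure A = mscale k (pushforward (@lebesgue_measure R) phi) A.
  apply: lebesgue_measure_unique => _ [[x y] _ <-] /=.
  rewrite /mscale /pushforward /=.
  have E0 : phi @^-1` `]x, y] = `](x - b) / c, (y - b) / c]%classic.
    apply/seteqP; split => z /=; rewrite /phi !in_itv /= ltr_pdivrMr// ler_pdivlMr//;
    by rewrite mulrC ltrBlDr lerBrDr.
  rewrite [X in (_ * X)%E](_ : _ = lebesgue_measure `](x - b) / c, (y - b) / c]%classic); last first.
    by rewrite -E0.
  rewrite !lebesgue_measure_itv /= !lte_fin.
  rewrite ltr_pM2r ?invr_gt0// ltrD2r; case: ifP => _; last by rewrite mule0.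
  by rewrite -!EFinB -EFinM -mulrBl mulrC divfK ?gt_eqF//; congr (_%:E); ring.
rewrite [RHS](eq_measure_integral (mscale k (pushforward (@lebesgue_measure R) phi))); last first.
  by move=> A mA _; exact: E.
by rewrite ge0_integral_mscale// ge0_integral_pushforward.
Qed.

Lemma ge0_integral_lebesgue_shift {R : realType} (b : R) (f : R -> \bar R) :
  measurable_fun setT f -> (forall x, (0 <= f x)%E) ->
  (\int[lebesgue_measure]_x f (x + b)%R = \int[lebesgue_measure]_x f x)%E.
Proof.
move=> mf f0; rewrite -(ge0_integral_lebesgue_affine b ltr01 mf f0) mul1e.
by apply: eq_integral => x _; rewrite mul1r.
Qed.

(** Used in place of Gamma(a) y^(-a), because [powR] gives 0 for a negative power of 0, whereas this
    integral is infinite there. *)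
Definition laplace_powR {R : realType} (a y : R) : \bar R :=
  (\int[lebesgue_measure]_(t in [set t : R | (0 < t)%R]) (t `^ (a - 1) * expR (- (t * y)))%R%:E)%E.

Lemma measurable_pos (R : realType) : measurable [set t : R | 0 < t].
Proof.
by rewrite (_ : [set t | _] = `]0, +oo[%classic)//; apply/seteqP; split => x /=; rewrite in_itv /= andbT.
Qed.
#[local] Hint Extern 0 (measurable _) => solve [exact: measurable_pos] : core.

Lemma patch_posE (R : realType) (f : R -> \bar R) (x : R) :
  (f \_ [set t : R | 0 < t]) x = if 0 < x then f x else 0%E.
Proof.
rewrite patchE; case: (boolP (0 < x)) => x0; first by rewrite mem_set.
by rewrite memNset//=; exact/negP.
Qed.

Lemma laplace_powR_ge0 (R : realType) (a y : R) : (0 <= laplace_powR a y)%E.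
Proof. by apply: integral_ge0 => t _; rewrite lee_fin mulr_ge0 ?powR_ge0 ?expR_ge0. Qed.

Lemma measurable_laplace_integrand (R : realType) (a y : R) D :
  measurable_fun D (fun t : R => (t `^ (a - 1) * expR (- (t * y)))%:E).
Proof.
apply: measurable_funTS; apply/measurable_EFinP/measurable_funM.
  exact: measurable_powR.
apply: measurableT_comp => //; apply: measurableT_comp => //; exact: measurable_funM.
Qed.

(** Substitution of t / c for t. No sign condition is put on [y]: the instance y = 0 will force the
    value +oo at 0. *)
Lemma laplace_powRM (R : realType) (a c y : R) : 0 < c ->
  laplace_powR a (c * y) = ((c `^ (- a))%R%:E * laplace_powR a y)%E.
Proof.
move=> c0; rewrite /laplace_powR integral_mkcond.
pose g : R -> \bar R := (fun t : R => (t `^ (a - 1) * expR (- (t * (c * y))))%:E) \_ [set t | 0 < t].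
have mg : measurable_fun setT g.
  apply/(measurable_restrictT _ (@measurable_pos R)); have := @measurable_laplace_integrand R a (c*y) [set t | 0 < t]; apply.
have g0 x : (0 <= g x)%E.
  by apply: erestrict_ge0 => t _; rewrite lee_fin mulr_ge0 ?powR_ge0 ?expR_ge0.
rewrite -[LHS]/(\int[lebesgue_measure]_x g x)%E.
have ci : 0 < c^-1 by rewrite invr_gt0.
rewrite -(ge0_integral_lebesgue_affine 0 ci mg g0).
have -> : (\int[lebesgue_measure]_x g (c^-1 * x + 0)%R =
  \int[lebesgue_measure]_(t in [set t : R | (0 < t)%R])
    ((c `^ (1 - a))%R%:E * (t `^ (a - 1) * expR (- (t * y)))%R%:E))%E.
  rewrite [RHS]integral_mkcond; apply: eq_integral => x _.
  rewrite /g !patch_posE addr0 pmulr_rgt0//.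
  case: ifPn => // x0; rewrite -EFinM; congr (_%:E).
  rewrite powRM ?ltW//.
  rewrite -[c^-1]powR_inv1 ?ltW// -powRrM [RHS]mulrA; congr (_ * _ * expR _).
    by congr (_ `^ _); ring.
  by rewrite powR_inv1 ?ltW//; field; rewrite gt_eqF.
rewrite ge0_integralZl//; last 3 first.
- exact: measurable_laplace_integrand.
- by move=> t _; rewrite lee_fin mulr_ge0 ?powR_ge0 ?expR_ge0.
- by rewrite lee_fin powR_ge0.
rewrite muleA -EFinM -[c^-1]powR_inv1 ?ltW// -powRD; last by rewrite (gt_eqF c0) implybT.
by congr ((_ `^ _)%:E * _)%E; ring.
Qed.

Lemma continuous_within_powR (R : realType) (q u v : R) : 0 < u ->
  {within `[u, v], continuous (fun t : R => t `^ q)}.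
Proof.
move=> u0; apply: derivable_within_continuous => x; rewrite in_itv /= => /andP[ux _].
by apply: derivable_powR; rewrite in_itv /= andbT (lt_le_trans u0).
Qed.

Lemma integral_powR_itv (R : realType) (a u v : R) : 0 < a -> 0 < u -> u < v ->
  (\int[lebesgue_measure]_(t in `[u, v]) (t `^ (a - 1))%:E =
   ((v `^ a - u `^ a) / a)%:E)%E.
Proof.
move=> a0 u0 uv.
have D (x : R) : 0 < x -> is_derive x 1 (fun t : R => t `^ a / a) (x `^ (a - 1)).
  move=> x0; have H := is_derive1_powR a x0.
  rewrite [X in is_derive _ _ _ X](_ : _ = a^-1 *: (a * x `^ (a - 1))); last first.
    by rewrite scalerA mulVf ?scale1r// gt_eqF.
  rewrite (_ : (fun _ => _) = a^-1 *: (fun t : R => t `^ a)); last first.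
    by apply/funext => t; rewrite mulrC.
  exact: is_deriveZ.
have cF (x : R) : 0 < x -> {for x, continuous (fun t : R => t `^ a / a)}.
  move=> x0; apply/differentiable_continuous/derivable1_diffP.
  by have [] := D x x0.
rewrite (continuous_FTC2 (F := fun t : R => t `^ a / a))//.
- by rewrite -EFinB mulrBl.
- exact: continuous_within_powR.
- split.
  + by move=> x; rewrite in_itv /= => /andP[ux _]; have [] := D x (lt_trans u0 ux).
  + exact/cvg_at_right_filter/cF.
  + exact/cvg_at_left_filter/cF/(lt_trans u0).
- move=> x; rewrite in_itv /= => /andP[ux _]; rewrite derive1E.
  by have [_ ->] := D x (lt_trans u0 ux).
Qed.

Lemma integral_powR_01 (R : realType) (a : R) : 0 < a ->
  (\int[lebesgue_measure]_(t in `]0%R, 1%R]) (t `^ (a - 1))%:E <= (a^-1)%:E)%E.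
Proof.
move=> a0.
(* [n.+2] keeps the left end strictly below 1, as [integral_powR_itv] requires. *)
pose F n := `[n.+2%:R^-1 : R, 1]%classic.
have -> : `]0%R, 1%R]%classic = \bigcup_n F n.
  apply/seteqP; split => x /=; rewrite in_itv /=.
    move=> /andP[x0 x1]; have [n xn] := ltr_add_invr x0.
    exists n => //; rewrite /F /= in_itv /= x1 andbT ltW//.
    rewrite add0r in xn; apply: le_lt_trans xn.
    by rewrite lef_pV2 ?posrE// ler_nat.
  by move=> [n _]; rewrite /F /= !in_itv /= => /andP[nx ->]; rewrite andbT (lt_le_trans _ nx).
have mG D : measurable_fun D (fun t : R => (t `^ (a - 1))%:E).
  by apply: measurable_funTS; apply/measurable_EFinP; exact: measurable_powR.
have C : (\int[lebesgue_measure]_(x in F i) (x `^ (a - 1))%:E)%E @[i --> \oo] -->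
    (\int[lebesgue_measure]_(x in \bigcup_i F i) (x `^ (a - 1))%:E)%E.
  apply: ge0_nondecreasing_set_cvg_integral.
  - move=> m n mn; rewrite subsetEset => x /=; rewrite /F /= !in_itv /= => /andP[mx ->].
    by rewrite andbT (le_trans _ mx)// lef_pV2 ?posrE// ler_nat.
  - by move=> n; exact: measurable_itv.
  - by move=> n; exact: mG.
  - by move=> n x _; rewrite lee_fin powR_ge0.
rewrite -(cvg_lim _ C)//; apply: lime_le; first exact: cvgP C.
near=> n; rewrite integral_powR_itv// ?invr_gt0// ?invf_lt1// ?ltr1n// powR1.
by rewrite lee_fin ler_pdivrMr// mulVf ?gt_eqF// gerBl powR_ge0.
Unshelve. all: by end_near. Qed.

Lemma ge0_integral_expR (R : realType) (r : R) : 0 < r ->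
  (\int[lebesgue_measure]_(t in [set t : R | (0 < t)%R]) (expR (- (r * t)))%:E <= (r^-1)%:E)%E.
Proof.
move=> r0.
have ri : 0 <= r^-1 by rewrite invr_ge0 ltW.
have mE : measurable_fun setT (fun t : R => (exponential_pdf r t)%:E).
  by apply/measurable_EFinP; exact: measurable_exponential_pdf.
have E0 (t : R) : (0 <= (exponential_pdf r t)%:E)%E.
  by rewrite lee_fin exponential_pdf_ge0// ltW.
rewrite -[leRHS]mule1 -[in leRHS](integral_exponential_pdf r0) -ge0_integralZl//.
apply: (@le_trans _ _ (\int[lebesgue_measure]_(t in [set t : R | (0 < t)%R])
    ((r^-1)%:E * (exponential_pdf r t)%:E))%E).
  rewrite le_eqVlt; apply/orP; left; apply/eqP; apply: eq_integral => t.
  rewrite inE /= => t0; rewrite exponential_pdfE ?ltW// -EFinM mulrA mulVf ?gt_eqF//.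
  by rewrite mul1r mulNr.
apply: ge0_subset_integral => //.
- by apply: measurable_funeM.
- by move=> t _; rewrite mule_ge0// lee_fin.
Qed.

Lemma laplace_powR1_fin (R : realType) (a : R) : 0 < a -> (laplace_powR a 1 < +oo)%E.
Proof.
move=> a0.
have [n na] : exists n, a < n.+1%:R.
  by exists (Num.bound a); rewrite (lt_trans (archi_boundP (ltW a0)))// ltr_nat.
(* [C] turns the term of degree n + 1 of the exponential series at t / 2 into [t ^+ n.+1]. Half of
   e^(-t) absorbs the power, the other half stays integrable. *)
pose C : R := (n.+1`!)%:R * 2 ^+ n.+1.
pose h (t : R) := if t <= 1 then t `^ (a - 1) else 0.
have C0 : 0 <= C by rewrite /C mulr_ge0.
have h0 t : 0 <= h t by rewrite /h; case: ifP => // _; rewrite powR_ge0.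
have E (t : R) : 0 < t -> t `^ (a - 1) * expR (- (t * 1)) <=
    h t + C * expR (- (2^-1 * t)).
  move=> t0; rewrite /h; case: ifPn => [t1|].
    rewrite -[leLHS]addr0 lerD//.
      by rewrite ler_piMr ?powR_ge0// expR_le1; lra.
    by rewrite mulr_ge0 ?expR_ge0.
  rewrite -ltNge add0r => t1.
  have -> : expR (- (t * 1)) = expR (- (2^-1 * t)) * expR (- (2^-1 * t)).
    by rewrite -expRD; congr expR; field.
  rewrite mulrA ler_wpM2r ?expR_ge0// expRN ler_pdivrMr ?expR_gt0//.
  apply: (@le_trans _ _ (t ^+ n.+1)).
    rewrite -powR_mulrn ?(ltW t0)//; apply: ler_powR; first exact: ltW.
    by lra.
  have t2 : 0 <= 2^-1 * t by rewrite mulr_ge0 ?invr_ge0 ?ltW.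
  have := expR_ge1Dxn n t2; set p := _ / _ => pe.
  have -> : t ^+ n.+1 = C * p.
    rewrite /p /C exprMn exprVn; field.
    by rewrite expf_neq0//= pnatr_eq0 -lt0n fact_gt0.
  by rewrite ler_wpM2l//; lra.
have mh : measurable_fun setT h.
  by apply: measurable_fun_ifT => //; apply: measurable_fun_ler.
have mh' D : measurable_fun D (fun t : R => (h t)%:E).
  by apply: measurable_funTS; exact/measurable_EFinP.
have me D : measurable_fun D (fun t : R => (expR (- (2^-1 * t)))%:E).
  by apply: measurable_funTS; apply/measurable_EFinP; apply: measurableT_comp => //;
    apply: measurableT_comp => //; exact: measurable_funM.
have me' D : measurable_fun D (fun t : R => C%:E * (expR (- (2^-1 * t)))%:E)%E.
  exact: measurable_funeM.
have e0 (t : R) : (0 <= (expR (- (2^-1 * t)))%:E)%E by rewrite lee_fin expR_ge0.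
rewrite /laplace_powR.
apply: (@le_lt_trans _ _ (\int[lebesgue_measure]_(t in [set t : R | (0 < t)%R])
    ((h t)%:E + C%:E * (expR (- (2^-1 * t)))%:E))%E).
  apply: ge0_le_integral => //.
  - by move=> t _; rewrite lee_fin mulr_ge0 ?powR_ge0 ?expR_ge0.
  - exact: measurable_laplace_integrand.
  - by apply: emeasurable_funD; [exact: mh'|exact: me'].
rewrite ge0_integralD//; try by [move=> t _; rewrite ?mule_ge0 ?lee_fin|exact: mh'|exact: me'].
rewrite ge0_integralZl//; last exact: me.
apply: lte_add_pinfty.
  apply: le_lt_trans (ltry (a^-1)).
  apply: le_trans (integral_powR_01 a0).
  rewrite [leLHS]integral_mkcond [leRHS]integral_mkcond.
  rewrite le_eqVlt; apply/orP; left; apply/eqP; apply: eq_integral => t _.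
  have E01 : (t \in `]0%R, 1%R]%classic) = (0 < t <= 1).
    by apply/idP/idP; rewrite inE /= in_itv.
  by rewrite patch_posE patchE E01 /h; case: (ltP 0 t) => //= _; case: (t <= 1).
apply: lte_mul_pinfty => //.
apply: le_lt_trans (ltry _); apply: ge0_integral_expR.
by rewrite invr_gt0.
Qed.

(** * Gaussian integrals on the line and in the plane *)

Lemma ge0_integral_normal_prob (R : realType) (m s : R) (f : R -> \bar R) :
  measurable_fun setT f -> (forall x, (0 <= f x)%E) ->
  (\int[normal_prob m s]_x f x = \int[lebesgue_measure]_x (f x * (normal_pdf m s x)%:E))%E.
Proof.
move=> mf f0.
have dom := normal_prob_dominates m s.
have mpdf : measurable_fun setT (fun x : R => (normal_pdf m s x)%:E).
  by apply/measurable_EFinP; exact: measurable_normal_pdf.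
have iRN := Radon_Nikodym_SigmaFinite.f_integrable dom.
rewrite -(Radon_Nikodym_SigmaFinite.change_of_variables dom)//.
apply: ge0_ae_eq_integral => //.
- by apply: emeasurable_funM => //; exact: measurable_int iRN.
- exact: emeasurable_funM.
- by move=> x _; rewrite mule_ge0//; exact: Radon_Nikodym_SigmaFinite.f_ge0.
- by move=> x _; rewrite mule_ge0// lee_fin normal_pdf_ge0.
(* The Radon-Nikodym derivative and the explicit density have the same integral over every
   measurable set, hence agree almost everywhere. *)
apply: ae_eqe_mul2l; apply: integral_ae_eq => //.
by move=> E _ mE; rewrite -Radon_Nikodym_SigmaFinite.f_integral.
Qed.

(** With k = 1 + 2 s^2 t, the integrand times the density of variance s^2 is k^(-1/2) times the
    density of variance s^2 / k, which has mass 1. *)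
Lemma laplace_sqr_normal_prob (R : realType) (s t : R) : s != 0 -> 0 <= t ->
  (\int[normal_prob 0 s]_x (expR (- (t * x ^+ 2)))%:E =
   ((1 + 2 * s ^+ 2 * t) `^ (- 2^-1))%:E)%E.
Proof.
move=> s0 t0.
have s2 : 0 < s ^+ 2 by rewrite exprn_even_gt0.
pose k := 1 + 2 * s ^+ 2 * t.
have k0 : 0 < k by rewrite /k; have := mulr_ge0 (ltW s2) t0; lra.
pose s' := Num.sqrt (s ^+ 2 / k).
have s'2 : s' ^+ 2 = s ^+ 2 / k by rewrite sqr_sqrtr// divr_ge0 ?ltW.
have s'0 : s' != 0 by rewrite gt_eqF// sqrtr_gt0 divr_gt0.
have mf : measurable_fun setT (fun x : R => (expR (- (t * x ^+ 2)))%:E).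
  apply/measurable_EFinP; apply: measurableT_comp => //.
  by apply: measurableT_comp => //; apply: measurable_funM => //; exact: measurable_funX.
rewrite (ge0_integral_normal_prob _ _ mf)//.
transitivity (\int[lebesgue_measure]_x ((k `^ (- 2^-1))%:E * (normal_pdf 0 s' x)%:E))%E; last first.
  have mp : measurable_fun setT (fun x : R => (normal_pdf 0 s' x)%:E).
    by apply/measurable_EFinP; exact: measurable_normal_pdf.
  have p0 (x : R) : setT x -> (0 <= (normal_pdf 0 s' x)%:E)%E.
    by rewrite lee_fin normal_pdf_ge0.
  by rewrite ge0_integralZl ?lee_fin ?powR_ge0// integral_normal_pdf mule1.
apply: eq_integral => x _; rewrite -!EFinM; congr (_%:E).
rewrite !normal_pdfE// /normal_peak /normal_fun !subr0 s'2.
have -> : Num.sqrt (s ^+ 2 / k * pi *+ 2) = k `^ (- 2^-1) * Num.sqrt (s ^+ 2 * pi *+ 2).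
  rewrite powRN powR12_sqrt ?ltW// -sqrtrV ?ltW// -sqrtrM ?invr_ge0 ?ltW//.
  congr Num.sqrt; move: (@pi R) => q; rewrite -!mulrnAr.
  by rewrite [RHS]mulrA [k^-1 * _]mulrC.
rewrite invfM [RHS]mulrA [k `^ _ * _]mulrA mulfV ?mul1r; last by rewrite gt_eqF// powR_gt0.
rewrite [LHS]mulrCA -expRD; congr (_ * expR _).
rewrite /k; field.
by rewrite s0 gt_eqF.
Qed.

Lemma ge0_integral_shearY (R : realType) (k : R) (F : R * R -> \bar R) :
  measurable_fun setT F -> (forall z, (0 <= F z)%E) ->
  (\int[lebesgue_measure]_x \int[lebesgue_measure]_y F (x, y + k * x)%R =
   \int[lebesgue_measure]_x \int[lebesgue_measure]_y F (x, y))%E.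
Proof.
move=> mF F0; apply: eq_integral => x _.
rewrite (@ge0_integral_lebesgue_shift _ (k * x) (fun y => F (x, y)))//.
by apply: measurableT_comp => //; exact: pair1_measurable.
Qed.

Lemma ge0_integral_shearX (R : realType) (k : R) (F : R * R -> \bar R) :
  measurable_fun setT F -> (forall z, (0 <= F z)%E) ->
  (\int[lebesgue_measure]_x \int[lebesgue_measure]_y F (x + k * y, y)%R =
   \int[lebesgue_measure]_x \int[lebesgue_measure]_y F (x, y))%E.
Proof.
move=> mF F0.
pose F' (z : R * R) := F (z.1 + k * z.2, z.2).
have mF' : measurable_fun setT F'.
  apply: measurableT_comp => //; apply/measurable_fun_pairP; split => /=; last exact: measurable_snd.
  by apply: measurable_funD; [exact: measurable_fst|exact: measurable_funM].
transitivity (\int[lebesgue_measure]_y \int[lebesgue_measure]_x F' (x, y))%E.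
  by apply: fubini_tonelli => // z; exact: F0.
transitivity (\int[lebesgue_measure]_y \int[lebesgue_measure]_x F (x, y))%E; last first.
  by symmetry; exact: fubini_tonelli.
apply: eq_integral => y _ /=.
rewrite (@ge0_integral_lebesgue_shift _ (k * y) (fun x => F (x, y)))//.
by apply: measurableT_comp => //; exact: pair2_measurable.
Qed.

(* A planar rotation other than the half turn is a product of three shears, along
   which Lebesgue measure is invariant by translation in one variable: this is
   why [-1 < c] is required of rotations. *)
Lemma ge0_integral_normal_rotation (R : realType) (sigma c s : R) (f : R * R -> \bar R) :
  sigma != 0 -> c ^+ 2 + s ^+ 2 = 1 -> -1 < c ->
  measurable_fun setT f -> (forall z, (0 <= f z)%E) ->
  (\int[normal_prob 0 sigma]_x \int[normal_prob 0 sigma]_y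
     f (c * x - s * y, s * x + c * y)%R =
   \int[normal_prob 0 sigma]_x \int[normal_prob 0 sigma]_y f (x, y))%E.
Proof.
move=> sigma0 cs1 c1 mf f0.
pose p (x : R) := normal_pdf 0 sigma x.
have mp : measurable_fun setT p by exact: measurable_normal_pdf.
have p0 x : 0 <= p x by exact: normal_pdf_ge0.
have E (g : R * R -> \bar R) : measurable_fun setT g -> (forall z, (0 <= g z)%E) ->
  (\int[normal_prob 0 sigma]_x \int[normal_prob 0 sigma]_y g (x, y) =
   \int[lebesgue_measure]_x \int[lebesgue_measure]_y (g (x, y) * (p x * p y)%:E))%E.
  move=> mg g0.
  have mG : measurable_fun setT (fun x => \int[normal_prob 0 sigma]_y g (x, y))%E.
    exact: (@measurable_fun_fubini_tonelli_F _ _ _ _ _ (normal_prob 0 sigma) g mg g0).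
  rewrite (ge0_integral_normal_prob _ _ mG)//; last by move=> x; exact: integral_ge0.
  apply: eq_integral => x _.
  have mgx : measurable_fun setT (fun y => g (x, y)).
    by apply: measurableT_comp => //; exact: pair1_measurable.
  rewrite ge0_integral_normal_prob// -ge0_integralZr//.
  - by apply: eq_integral => y _; rewrite -muleA -EFinM [(_ * p x)%R]mulrC.
  - by apply: emeasurable_funM => //; apply/measurable_EFinP.
  - by move=> y _; rewrite mule_ge0// lee_fin.
  - by rewrite lee_fin.
have mrot : measurable_fun setT (fun z : R * R => (c * z.1 - s * z.2, s * z.1 + c * z.2)).
  apply/measurable_fun_pairP; split => /=.
    by apply: measurable_funB; exact: measurable_funM.
  by apply: measurable_funD; exact: measurable_funM.
rewrite (E f)//.
rewrite (E (fun z => f (c * z.1 - s * z.2, s * z.1 + c * z.2)))//; last exact: measurableT_comp.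
pose F (z : R * R) := (f z * (p z.1 * p z.2)%:E)%E.
have mF : measurable_fun setT F.
  apply: emeasurable_funM => //; apply/measurable_EFinP; apply: measurable_funM; exact: measurableT_comp.
have F0 z : (0 <= F z)%E by rewrite mule_ge0// lee_fin mulr_ge0.
(* For the angle theta with cosine c and sine s, k = - tan (theta / 2): the rotation is the
   horizontal shear by k, the vertical shear by s, then the horizontal shear by k again. *)
pose k := - (s / (1 + c)).
have c10 : 1 + c != 0 by rewrite gt_eqF//; lra.
pose FA (z : R * R) := F (z.1 + k * z.2, z.2).
pose FAB (z : R * R) := FA (z.1, z.2 + s * z.1).
have mFA : measurable_fun setT FA.
  apply: measurableT_comp => //; apply/measurable_fun_pairP; split => /=; last exact: measurable_snd.
  by apply: measurable_funD; [exact: measurable_fst|exact: measurable_funM].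
have mFAB : measurable_fun setT FAB.
  apply: measurableT_comp => //; apply/measurable_fun_pairP; split => /=; first exact: measurable_fst.
  by apply: measurable_funD; [exact: measurable_snd|exact: measurable_funM].
transitivity (\int[lebesgue_measure]_x \int[lebesgue_measure]_y FAB (x + k * y, y)%R)%E; last first.
  have e1 := ge0_integral_shearX k mF F0.
  have e2 := ge0_integral_shearY s mFA (fun z => F0 _).
  have e3 := ge0_integral_shearX k mFAB (fun z => F0 _).
  exact: (etrans e3 (etrans e2 e1)).
apply: eq_integral => x _; apply: eq_integral => y _.
rewrite /FAB /FA /F /=.
have s2 : s ^+ 2 = (1 - c) * (1 + c) by rewrite -[LHS](addKr (c ^+ 2)) cs1; ring.
have e2 : y + s * (x + k * y) = s * x + c * y.
  have -> : y + s * (x + k * y) = s * x + (1 - s ^+ 2 / (1 + c)) * y by rewrite /k; field.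
  by rewrite s2 mulfK//; ring.
have e1 : x + k * y + k * (y + s * (x + k * y)) = c * x - s * y.
  have -> : x + k * y + k * (y + s * (x + k * y)) =
     (1 - s ^+ 2 / (1 + c)) * x + (k + k + s ^+ 2 / (1 + c) * s / (1 + c)) * y.
    by rewrite /k; field.
  rewrite s2 mulfK// /k.
  have -> : - (s / (1 + c)) - s / (1 + c) + (1 - c) * s / (1 + c) = - s by field.
  ring.
rewrite e1 e2; congr (_ * _%:E)%E.
rewrite /p !normal_pdfE// mulrACA [RHS]mulrACA; congr (_ * _).
rewrite /normal_fun -!expRD; congr expR; rewrite !subr0.
rewrite !mulNr -!opprD -!mulrDl; congr (- (_ / _)).
have -> : (c * x - s * y) ^+ 2 + (s * x + c * y) ^+ 2 = (c ^+ 2 + s ^+ 2) * (x ^+ 2 + y ^+ 2) by ring.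
by rewrite cs1 mul1r.
Qed.

(** * The Gamma function: positivity, a Beta integral, differentiability *)

Lemma laplace_powR1 (R : realType) (a : R) : 0 < a -> laplace_powR a 1 = (Gamma a)%:E.
Proof.
move=> a0; rewrite /Gamma.
have -> : (\int[lebesgue_measure]_(t in [set t : R | (0 < t)%R])
    (t `^ (a - 1) * expR (- t))%:E)%E = laplace_powR a 1.
  by apply: eq_integral => t _; rewrite mulr1.
by rewrite fineK// ge0_fin_numE ?laplace_powR1_fin// laplace_powR_ge0.
Qed.

Lemma Gamma_gt0 (R : realType) (a : R) : 0 < a -> 0 < Gamma a.
Proof.
move=> a0; rewrite -lte_fin -laplace_powR1//.
(* On [1, 2] both t and ln t lie between 0 and 2, so [c] bounds the integrand from below whatever
   the sign of a - 1. *)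
pose c : R := expR (- (2 * `|a - 1|) - 2).
apply: (@lt_le_trans _ _ (\int[lebesgue_measure]_(t in `[1%R, 2%R]) c%:E)%E).
  rewrite integral_cst//= lebesgue_measure_itv /= lte_fin ltr1n -EFinB -EFinM lte_fin.
  by rewrite mulr_gt0 ?expR_gt0// subr_gt0 ltr1n.
have sub : `[1%R, 2%R] `<=` [set t : R | 0 < t].
  by move=> t /=; rewrite in_itv /= => /andP[t1 _]; lra.
apply: (@le_trans _ _ (\int[lebesgue_measure]_(t in `[1%R, 2%R])
   (t `^ (a - 1) * expR (- (t * 1)))%:E)%E).
  apply: ge0_le_integral => //.
  - by move=> t _; rewrite lee_fin expR_ge0.
  - exact: measurable_laplace_integrand.
  - move=> t /=; rewrite in_itv /= => /andP[t1 t2]; rewrite lee_fin.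
    rewrite /powR gt_eqF ?(lt_le_trans _ t1)// -expRD ler_expR /c mulr1 lerD ?lerN2//.
    have lt0 : 0 <= ln t by exact: ln_ge0.
    have lt2 : ln t <= 2 by apply: le_trans t2; apply/ltW/ln_sublinear/(lt_le_trans _ t1).
    rewrite lerNl -mulNr; apply: (@le_trans _ _ (`|a - 1| * ln t)).
      by rewrite ler_wpM2r// -normrN ler_norm.
    by rewrite mulrC ler_wpM2r.
apply: ge0_subset_integral => //.
- exact: measurable_laplace_integrand.
- by move=> t _; rewrite lee_fin mulr_ge0 ?powR_ge0 ?expR_ge0.
Qed.

Lemma laplace_powR_gt0E (R : realType) (a y : R) : 0 < a -> 0 < y ->
  laplace_powR a y = (y `^ (- a) * Gamma a)%:E.
Proof. by move=> a0 y0; rewrite -[y in LHS]mulr1 laplace_powRM// laplace_powR1. Qed.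

(** Scaling fixes the point 0, so the value L satisfies L = 2^(-a) L; as L > 0 and 2^(-a) differs
    from 1, L is infinite. *)
Lemma laplace_powR0 (R : realType) (a : R) : 0 < a -> laplace_powR a 0 = +oo%E.
Proof.
move=> a0.
have G0 : (0 < laplace_powR a 0)%E.
  apply: (@lt_le_trans _ _ (laplace_powR a 1)).
    by rewrite laplace_powR1// lte_fin Gamma_gt0.
  apply: ge0_le_integral => //.
  - by move=> t _; rewrite lee_fin mulr_ge0 ?powR_ge0 ?expR_ge0.
  - exact: measurable_laplace_integrand.
  - exact: measurable_laplace_integrand.
  - move=> t /= t0; rewrite lee_fin ler_wpM2l ?powR_ge0// ler_expR; lra.
have := @laplace_powRM R a 2 0; rewrite mulr0 => /(_ (ltr0Sn _ _)).
case: (laplace_powR a 0) G0 => [r|//|//]; rewrite lte_fin => r0.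
move=> /(congr1 fine) /= /eqP rE; exfalso; move: rE.
rewrite -subr_eq0 -[X in X - _]mul1r -mulrBl mulf_eq0 (gt_eqF r0) orbF subr_eq0.
by rewrite eq_sym powR_eq1 oppr_eq0 (gt_eqF a0) orbF => /orP[/eqP|]; lra.
Qed.

Lemma le_laplace_powR (R : realType) (a y : R) : 0 < a -> 0 < y ->
  ((Gamma a * (1 - a * ln y))%:E <= laplace_powR a y)%E.
Proof.
move=> a0 y0; rewrite laplace_powR_gt0E// lee_fin mulrC.
apply: ler_wpM2r; first exact/ltW/Gamma_gt0.
by have := expR_ge1Dx (- a * ln y); rewrite /powR gt_eqF// mulNr.
Qed.

Lemma measurable_fun2_powR (R : realType) d (T : measurableType d) (f : T -> R) (b : R) :
  measurable_fun setT f -> measurable_fun setT (fun t => f t `^ b).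
Proof. by move=> mf; apply: (measurableT_comp (measurable_powR b)). Qed.

(** A Beta integral: Gamma(b) (1 + t c)^(-b) is itself a Laplace integral in u, and Tonelli
    exchanges the two. Leaving [laplace_powR a c] unevaluated covers c = 0, where both sides are
    infinite. *)
Lemma integral_powR_1DM (R : realType) (a b c : R) : 0 < a -> a < b -> 0 <= c ->
  (\int[lebesgue_measure]_(t in [set t : R | (0 < t)%R])
     (t `^ (a - 1) * (1 + t * c) `^ (- b))%:E =
   (Gamma (b - a) / Gamma b)%:E * laplace_powR a c)%E.
Proof.
move=> a0 ab c0.
have b0 : 0 < b by exact: lt_trans ab.
have [G [G0 GE]] : exists G : R, 0 < G /\ G = Gamma b by exists (Gamma b); rewrite Gamma_gt0.
have [G' GE'] : exists G' : R, G' = Gamma (b - a) by eexists.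
rewrite -GE -GE'.
have Lb (y : R) : 0 < y -> laplace_powR b y = (y `^ (- b) * G)%:E.
  by move=> y0; rewrite GE laplace_powR_gt0E.
have Lba : laplace_powR (b - a) 1 = G'%:E by rewrite GE' laplace_powR1// subr_gt0.
have LM (y : R) : 0 < y -> laplace_powR a (y * c) = ((y `^ (- a))%:E * laplace_powR a c)%E.
  by move=> y0; exact: laplace_powRM.
move: {GE GE'} (laplace_powR a c) Lb Lba LM (laplace_powR_ge0 a c) => L Lb Lba LM L0.
pose k (t u : R) : R := if (0 < t) && (0 < u) then
  t `^ (a - 1) * u `^ (b - 1) * expR (- (u * (1 + t * c))) else 0.
have k0 t u : 0 <= k t u.
  by rewrite /k; case: ifP => // _; rewrite !mulr_ge0 ?powR_ge0 ?expR_ge0.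
have mk : measurable_fun setT (fun z : R * R => (k z.1 z.2)%:E).
  apply/measurable_EFinP; apply: measurable_fun_ifT => //.
    apply: measurable_and; apply: measurable_fun_ltr => //.
  apply: measurable_funM; first by apply: measurable_funM; exact: measurable_fun2_powR.
  apply: measurableT_comp => //; apply: measurableT_comp => //.
  by apply: measurable_funM => //; apply: measurable_funD => //; exact: measurable_funM.
have tU (t : R) : 0 < t -> (\int[lebesgue_measure]_u (k t u)%:E =
    (t `^ (a - 1))%:E * laplace_powR b (1 + t * c)%R)%E.
  move=> t0; rewrite -ge0_integralZl//; last 3 first.
  - exact: measurable_laplace_integrand.
  - by move=> u _; rewrite lee_fin mulr_ge0 ?powR_ge0 ?expR_ge0.
  - by rewrite lee_fin powR_ge0.
  rewrite [RHS]integral_mkcond; apply: eq_integral => u _.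
  by rewrite patch_posE /k t0 /=; case: ifP => // _; rewrite -EFinM mulrA.
have uT (u : R) : 0 < u -> (\int[lebesgue_measure]_t (k t u)%:E =
    (u `^ (b - 1) * expR (- u))%:E * laplace_powR a (u * c)%R)%E.
  move=> u0; rewrite -ge0_integralZl//; last 3 first.
  - exact: measurable_laplace_integrand.
  - by move=> t _; rewrite lee_fin mulr_ge0 ?powR_ge0 ?expR_ge0.
  - by rewrite lee_fin mulr_ge0 ?powR_ge0 ?expR_ge0.
  rewrite [RHS]integral_mkcond; apply: eq_integral => t _.
  rewrite patch_posE /k u0 /= andbT; case: ifP => // _; rewrite -EFinM; congr (_%:E).
  have -> : - (u * (1 + t * c)) = - u + - (t * (u * c)) by ring.
  rewrite expRD; ring.
have nk t u : ~~ (0 < t) -> k t u = 0 by rewrite /k => /negbTE ->.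
have nk' t u : ~~ (0 < u) -> k t u = 0 by rewrite /k andbC => /negbTE ->.
clearbody k.
have H := @fubini_tonelli _ _ _ _ _ (@lebesgue_measure R) (@lebesgue_measure R) _ mk
  (fun z => k0 z.1 z.2).
suff M : (G%:E * \int[lebesgue_measure]_(t in [set t : R | (0 < t)%R])
     (t `^ (a - 1) * (1 + t * c) `^ (- b))%:E = G'%:E * L)%E.
  have -> : (G' / G)%:E = ((G^-1)%:E * G'%:E)%E by rewrite -EFinM mulrC.
  move: M; move: (integral _ _ _) => I M.
  have Gn0 : G != 0 by rewrite gt_eqF.
  by rewrite -muleA -M muleA -EFinM (mulVf Gn0) mul1e.
have mI : measurable_fun [set t : R | 0 < t] (fun t => (t `^ (a - 1) * (1 + t * c) `^ (- b))%:E).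
  apply: measurable_funTS; apply/measurable_EFinP.
  apply: measurable_funM; first exact: measurable_powR.
  apply: measurable_fun2_powR; apply: measurable_funD; first exact: measurable_cst.
  apply: measurable_funM; [exact: measurable_id|exact: measurable_cst].
rewrite -ge0_integralZl//; last 2 first.
- by move=> t _; rewrite lee_fin mulr_ge0 ?powR_ge0.
- by rewrite lee_fin ltW.
transitivity (\int[lebesgue_measure]_t \int[lebesgue_measure]_u (k t u)%:E)%E.
  rewrite [LHS]integral_mkcond; apply: eq_integral => t _; rewrite patch_posE; case: ifPn => t0.
    rewrite tU// Lb; last by rewrite ltr_wpDr// mulr_ge0// ltW.
    by rewrite -!EFinM; congr (_%:E); ring.
  by rewrite integral0_eq// => u _; rewrite nk.
rewrite H.
transitivity (\int[lebesgue_measure]_(u in [set u : R | (0 < u)%R])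
    (L * (u `^ (b - a - 1) * expR (- (u * 1)))%:E))%E.
  rewrite [RHS]integral_mkcond; apply: eq_integral => u _.
  rewrite patch_posE; case: ifPn => u0; last by rewrite integral0_eq// => t _; rewrite nk'.
  rewrite uT// LM// muleA -EFinM muleC; congr (_ * _%:E)%E.
  rewrite mulrAC -powRD ?(gt_eqF u0) ?implybT// mulr1; congr (_ `^ _ * _); ring.
rewrite ge0_integralZl//; last 2 first.
- exact: measurable_laplace_integrand.
- by move=> t _; rewrite lee_fin mulr_ge0 ?powR_ge0 ?expR_ge0.
rewrite -/(laplace_powR (b - a) 1) Lba.
by rewrite muleC.
Qed.

Lemma integrable_Gamma (R : realType) (x : R) : 0 < x ->
  (@lebesgue_measure R).-integrable [set t : R | 0 < t] (EFin \o (fun t => t `^ (x - 1) * expR (- t))).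
Proof.
move=> x0; apply/integrableP; split.
  rewrite (_ : EFin \o _ = fun t : R => (t `^ (x - 1) * expR (- (t * 1)))%:E).
    exact: measurable_laplace_integrand.
  by apply/funext => t /=; rewrite mulr1.
have -> : (\int[lebesgue_measure]_(t in [set t : R | (0 < t)%R])
    `|(EFin \o (fun t : R => (t `^ (x - 1) * expR (- t))%R)) t|)%E = laplace_powR x 1.
  apply: eq_integral => t _ /=.
  by rewrite mulr1 ger0_norm// mulr_ge0 ?powR_ge0 ?expR_ge0.
exact: laplace_powR1_fin.
Qed.

Lemma is_derive_powRr (R : realType) (t x : R) : 0 < t ->
  is_derive x 1 (fun x => t `^ (x - 1) * expR (- t)) (ln t * (t `^ (x - 1) * expR (- t))).
Proof.
move=> t0.
have -> : (fun x => t `^ (x - 1) * expR (- t)) = (fun x => expR ((x - 1) * ln t) * expR (- t)).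
  by apply/funext => z; rewrite /powR gt_eqF.
have d1 : is_derive x 1 (fun x : R => (x - 1) * ln t) (ln t).
  rewrite (_ : (fun _ => _) = (fun x : R => ln t *: (x - 1))); last first.
    by apply/funext => z; rewrite mulrC.
  apply: is_derive_eq; rewrite ?subr0.
  by rewrite scaler1.
have d2 : is_derive x 1 (fun x : R => expR ((x - 1) * ln t)) (expR ((x - 1) * ln t) * ln t).
  have := @is_derive1_comp _ expR (fun x : R => (x - 1) * ln t) x.
  by move=> /(_ _ _ _ d1); apply; exact: is_derive_expR.
rewrite (_ : (fun _ => _) = (fun x : R => expR (- t) *: expR ((x - 1) * ln t))); last first.
  by apply/funext => z; rewrite mulrC.
apply: is_derive_eq; rewrite /powR gt_eqF//.
by rewrite /GRing.scale /=; ring.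
Qed.

Lemma derivable_Gamma (R : realType) (a : R) : 0 < a -> derivable (@Gamma R) a 1.
Proof.
move=> a0.
pose B := [set t : R | 0 < t].
pose f (x t : R) := t `^ (x - 1) * expR (- t).
(* Dominates |ln t| f(x, t) for a/2 < x < a + 1. For t >= 1, ln t <= t raises the exponent to a + 1;
   for t < 1, |ln t| <= (4/a) t^(-a/4) lowers it from a/2 - 1 to a/4 - 1, still integrable at 0. *)
pose G (t : R) := 4 / a * f (a / 4) t + f (a + 2) t.
have f0 (x t : R) : 0 <= f x t by rewrite /f mulr_ge0 ?powR_ge0 ?expR_ge0.
have df (x t : R) : 0 < t -> is_derive x 1 (f ^~ t) (ln t * f x t) by exact: is_derive_powRr.
apply: (@derivable_under_integral R _ _ (@lebesgue_measure R) f B (@measurable_pos R) a (a / 2) (a + 1) _ _ _ G).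
- by rewrite /= in_itv /=; apply/andP; split; lra.
- by move=> x; rewrite /= in_itv /= => /andP[ax _]; apply: integrable_Gamma; lra.
- by move=> x t _ t0; have [] := df x t t0.
- by move=> t; rewrite addr_ge0// mulr_ge0// divr_ge0// ltW.
- have -> : EFin \o G = (fun t => (4 / a)%R%:E * (EFin \o f (a / 4)%R) t + (EFin \o f (a + 2)%R) t)%E.
    by apply/funext => t; rewrite /= /G EFinD EFinM.
  apply: integrableD => //; last by apply: integrable_Gamma; lra.
  by apply: integrableZl => //; apply: integrable_Gamma; rewrite divr_gt0.
- move=> x t; rewrite /= in_itv /= => /andP[ax xa] t0.
  have [_ E] := df x t t0; rewrite /partial1of2 derive1E E normrM [X in _ * X]ger0_norm//.
  have [t1|t1] := leP 1 t.
    have -> : `|ln t| = ln t by rewrite ger0_norm// ln_ge0.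
    apply: (@le_trans _ _ (f (a + 2) t)); last first.
      by rewrite /G lerDr mulr_ge0// divr_ge0// ltW.
    rewrite /f mulrA ler_wpM2r ?expR_ge0//.
    apply: (@le_trans _ _ (t * t `^ (a + 1 - 1))).
      apply: ler_pM; [exact: ln_ge0|exact: powR_ge0|exact/ltW/ln_sublinear|].
      by apply: ler_powR => //; lra.
    have -> : t * t `^ (a + 1 - 1) = t `^ (a + 1) by apply: mulr_powRB1; [exact: ltW|lra].
    by apply: ler_powR => //; lra.
  apply: (@le_trans _ _ (4 / a * f (a / 4) t)); last by rewrite /G lerDl.
  have lnt : `|ln t| <= 4 / a * t `^ (- (a / 4)).
    rewrite ler0_norm; last by rewrite ln_le0// ltW.
    have := expR_ge1Dx (- (a / 4) * ln t); rewrite /powR gt_eqF// => H.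
    rewrite -ler_pdivrMl; last by rewrite divr_gt0.
    rewrite invf_div; apply: le_trans H; rewrite mulNr mulrN; lra.
  rewrite /f !mulrA ler_wpM2r ?expR_ge0//.
  apply: (@le_trans _ _ (4 / a * t `^ (- (a / 4)) * t `^ (a / 2 - 1))).
    apply: ler_pM => //; first exact: powR_ge0.
    by apply: ger_powR; [rewrite t0 ltW|lra].
  rewrite -mulrA ler_wpM2l//; first by rewrite divr_ge0// ltW.
  rewrite -powRD; last by rewrite (gt_eqF t0) implybT.
  by rewrite le_eqVlt; apply/orP; left; apply/eqP; congr (_ `^ _); field.
Qed.

(* Measurability is tested along measurable families, so that no sigma-algebra on
   [I -> R] is needed. *)
Definition mfunctional (R : realType) (I : Type) (f : (I -> R) -> \bar R) : Prop :=
  (forall w, (0 <= f w)%E) /\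
  forall d (T : measurableType d) (X : I -> T -> R), (forall i, measurable_fun setT (X i)) ->
    measurable_fun setT (fun t => f (X^~ t)).

(** Independence and the common law in one equation. With every [B i] the full line it also gives
    total mass 1, so [m] may be a bare measure, such as a product measure. *)
Definition iid_normal (R : realType) (sigma : R) d (T : measurableType d)
    (m : {measure set T -> \bar R}) (I : finType) (X : I -> T -> R) : Prop :=
  (forall i, measurable_fun setT (X i)) /\
  forall B : I -> set R, (forall i, measurable (B i)) ->
    m (\bigcap_(i in [set: I]) (X i @^-1` B i)) = (\prod_(i : I) normal_prob 0 sigma (B i))%E.

(** * Iid Gaussian families: uniqueness of the law and resampling *)

Section iid_normal.
Context {R : realType}.
Variable sigma : R.
Local Notation N := (normal_prob 0 sigma).
Local Notation iid := (iid_normal sigma).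

Lemma normal_prob_setT : N [set: R] = 1%E.
Proof. exact: probability_setT. Qed.

Lemma iid_normal_setT d (T : measurableType d) (m : {measure set T -> \bar R})
  (I : finType) (X : I -> T -> R) : iid m X -> m setT = 1%E.
Proof.
move=> [_ /(_ (fun=> setT))]; rewrite big1 => [|i _]; last exact: normal_prob_setT.
by move=> /(_ (fun=> measurableT)); rewrite bigcapT.
Qed.

Definition rectangles (I : finType) : set (set (I -> R)) :=
  [set A | exists2 B : I -> set R, (forall i, measurable (B i)) &
    A = \bigcap_(i in [set: I]) [set w | B i (w i)]].

(** Both image measures agree on the rectangles, a pi-system, hence on the sigma-algebra they
    generate. [f] is measurable for it because the coordinate maps are themselves a measurable
    family. *)
Lemma iid_normal_integral d (T : measurableType d) (m : {measure set T -> \bar R})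
   d' (T' : measurableType d') (m' : {measure set T' -> \bar R})
   (I : finType) (X : I -> T -> R) (Y : I -> T' -> R) f :
  iid m X -> iid m' Y -> mfunctional f ->
  (\int[m]_t f (X^~ t) = \int[m']_t f (Y^~ t))%E.
Proof.
move=> iX iY [f0 mf].
pose W := g_sigma_algebraType (@rectangles I).
have mW d1 (S : measurableType d1) (Z : I -> S -> R) : (forall i, measurable_fun setT (Z i)) ->
    measurable_fun setT ((fun t => Z^~ t) : S -> W).
  move=> mZ; apply: measurability; first exact: erefl.
  move=> _ [_ [B mB ->] <-]; rewrite setTI preimage_bigcap.
  apply: fin_bigcap_measurable => // i _.
  by rewrite -[X in measurable X]setTI; exact: mZ.
have mc i : measurable_fun setT (fun w : W => w i).
  move=> _ B mB; rewrite setTI; apply: sub_sigma_algebra.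
  exists (fun k => if k == i then B else setT); first by move=> k; case: ifP.
  apply/seteqP; split => w /=.
    by move=> wB k _ /=; case: eqP => [->|].
  by move=> /(_ i Logic.I) /=; rewrite eqxx.
have mfW : measurable_fun setT (f : W -> \bar R) by exact: mf mc.
pose XW : T -> W := fun t => X^~ t; pose YW : T' -> W := fun t => Y^~ t.
have mX : measurable_fun setT XW by apply: mW; exact: iX.1.
have mY : measurable_fun setT YW by apply: mW; exact: iY.1.
have E (A : set W) : measurable A -> (pushforward m XW : {measure set W -> \bar R}) A =
    (pushforward m' YW : {measure set W -> \bar R}) A.
  apply: (@measure_unique _ R W (@rectangles I) (fun=> setT)) => //.
  - move=> _ _ [B mB ->] [B' mB' ->]; exists (fun i => B i `&` B' i).
      by move=> i; exact: measurableI.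
    by rewrite -bigcapI.
  - move=> _; exists (fun=> setT) => //; by rewrite bigcapT.
  - by rewrite bigcup_const//; exists 0%N.
  - move=> _ [B mB ->]; rewrite -[LHS]/(m (XW @^-1` _)) -[RHS]/(m' (YW @^-1` _)).
    rewrite !preimage_bigcap.
    by have /= -> := iX.2 B mB; have /= -> := iY.2 B mB.
  - move=> _; rewrite -[X in (X < _)%E]/(m (XW @^-1` setT)).
    by rewrite preimage_setT (iid_normal_setT iX) ltry.
transitivity (\int[pushforward m XW]_w f w)%E.
  by rewrite [RHS](ge0_integral_pushforward mX)// => w _; exact: f0.
transitivity (\int[pushforward m' YW]_w f w)%E.
  by apply: eq_measure_integral => A mA _; exact: E.
by rewrite [LHS](ge0_integral_pushforward mY)// => w _; exact: f0.
Qed.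

(** Coordinates outside the image of [phi] are left unconstrained and contribute a factor 1. This
    covers rows, submatrices and transposes of a Gaussian matrix. *)
Lemma iid_normal_comp d (T : measurableType d) (m : {measure set T -> \bar R})
   (I J : finType) (X : I -> T -> R) (phi : J -> I) : injective phi ->
  iid m X -> iid m (fun j => X (phi j)).
Proof.
move=> inj [mX rX]; split => [j|B mB]; first exact: mX.
pose B' i := if [pick j | phi j == i] is Some j then B j else setT.
have B'phi j : B' (phi j) = B j.
  by rewrite /B'; case: pickP => [k /eqP/inj -> //|/(_ j)]; rewrite eqxx.
have mB' i : measurable (B' i) by rewrite /B'; case: pickP.
have := rX B' mB'.
have -> : \bigcap_(i in [set: I]) (X i @^-1` B' i) =
    \bigcap_(j in [set: J]) (X (phi j) @^-1` B j).
  apply/seteqP; split => t /= H.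
    by move=> j _ /=; rewrite -B'phi; exact: H.
  move=> i _ /=; rewrite /B'; case: pickP => [j /eqP <-|//]; exact: H.
move=> ->; rewrite (bigID (mem (phi @: finset.setTfor J))) /= [X in (_ * X)%E]big1 ?mule1.
  rewrite big_imset /=; last by move=> ? ? _ _; exact: inj.
  by apply: eq_big => [j|j _]; [rewrite finset.in_setT|rewrite B'phi].
move=> i /imsetP ni; rewrite /B'; case: pickP => [j /eqP ji|_].
  by case: ni; exists j; rewrite ?finset.in_setT.
exact: normal_prob_setT.
Qed.

(* Independence is exploited by resampling: integrals of an iid family do not
   change when the coordinates outside [A] are replaced by an independent copy. *)
Definition mix (I : finType) (A : pred I) (T T' : Type) (X : I -> T -> R) (X' : I -> T' -> R)
  (t : T) (t' : T') : I -> R := fun i => if A i then X i t else X' i t'.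

Lemma iid_normal_mix d (T : measurableType d) (P : probability T R)
    d' (T' : measurableType d') (P' : probability T' R)
    (I : finType) (A : pred I) (X : I -> T -> R) (X' : I -> T' -> R) :
  iid P X -> iid P' X' -> iid (P \x P')%E (fun i z => mix A X X' z.1 z.2 i).
Proof.
move=> [mX rX] [mX' rX']; split => [i|B mB].
  by rewrite /mix; case: (A i); exact: measurableT_comp.
pose B1 i := if A i then B i else setT; pose B2 i := if A i then setT else B i.
have mB1 i : measurable (B1 i) by rewrite /B1; case: ifP.
have mB2 i : measurable (B2 i) by rewrite /B2; case: ifP.
pose E1 := \bigcap_(i in [set: I]) (X i @^-1` B1 i).
pose E2 := \bigcap_(i in [set: I]) (X' i @^-1` B2 i).
have -> : \bigcap_(i in [set: I]) ((fun z : T * T' => mix A X X' z.1 z.2 i) @^-1` B i) = E1 `*` E2.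
  apply/seteqP; split => [[t t'] H|[t t'] [H1 H2]] /=.
    split => i _ /=; have := H i Logic.I; rewrite /mix /B1 /B2 /=; by case: (A i).
  move=> i _ /=; have := H1 i Logic.I; have := H2 i Logic.I.
  by rewrite /mix /B1 /B2 /=; case: (A i).
have mE1 : measurable E1.
  apply: fin_bigcap_measurable => // i _; rewrite -[X in measurable X]setTI; exact: mX.
have mE2 : measurable E2.
  apply: fin_bigcap_measurable => // i _; rewrite -[X in measurable X]setTI; exact: mX'.
rewrite -[LHS]/((P \x P')%E (E1 `*` E2)) product_measure1E// rX// rX'// -big_split /=; apply: eq_bigr => i _.
by rewrite /B1 /B2; case: (A i); rewrite normal_prob_setT ?mule1 ?mul1e.
Qed.

Lemma iid_normal_resample d (T : measurableType d) (P : probability T R)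
    d' (T' : measurableType d') (P' : probability T' R)
    (I : finType) (A : pred I) (X : I -> T -> R) (X' : I -> T' -> R) f :
  iid P X -> iid P' X' -> mfunctional f ->
  (\int[P]_t f (X^~ t) = \int[P]_t \int[P']_t' f (mix A X X' t t'))%E.
Proof.
move=> iX iX' mf; have iM := iid_normal_mix A iX iX'.
rewrite (iid_normal_integral iX iM mf) fubini_tonelli1//.
- exact: mf.2 iM.1.
- by move=> z; exact: mf.1.
Qed.

Lemma iid_normal_id : iid N (fun (i : unit) (x : R) => x).
Proof.
split => [i|B mB]; first exact: measurable_id.
rewrite (bigD1 tt)//= big1 ?mule1 => [|[]//]; congr (normal_prob _ _ _).
by apply/seteqP; split => [x /(_ tt Logic.I)//|x Bx [] _].
Qed.

Lemma iid_normal_integral1 d (T : measurableType d) (m : {measure set T -> \bar R})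
    (I : finType) (X : I -> T -> R) (i : I) (f : R -> \bar R) :
  iid m X -> measurable_fun setT f -> (forall x, (0 <= f x)%E) ->
  (\int[m]_t f (X i t) = \int[N]_x f x)%E.
Proof.
move=> iX mf f0; have inj : injective (fun _ : unit => i) by move=> [] [].
have := iid_normal_integral (f := fun w => f (w tt)) (iid_normal_comp inj iX) iid_normal_id.
by apply; split => // d1 T1 Z mZ; exact: measurableT_comp.
Qed.

Lemma iid_normal_pair : iid (N \x N)%E (fun (b : bool) (z : R * R) => if b then z.1 else z.2).
Proof.
split => [b|B mB].
  by case: b => /=; [exact: measurable_fst|exact: measurable_snd].
have -> : \bigcap_(b in [set: bool]) ((fun z : R * R => if b then z.1 else z.2) @^-1` B b) =
    B true `*` B false.
  apply/seteqP; split => [z H|z [H1 H2] [] _//].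
  by split; [exact: (H true)|exact: (H false)].
rewrite -[LHS]/((N \x N)%E (B true `*` B false)) product_measure1E ?big_bool//; exact: mB.
Qed.

Lemma iid_normal_integral2 d (T : measurableType d) (m : {measure set T -> \bar R})
    (I : finType) (X : I -> T -> R) (i j : I) (f : R * R -> \bar R) : i != j ->
  iid m X -> measurable_fun setT f -> (forall z, (0 <= f z)%E) ->
  (\int[m]_t f (X i t, X j t) = \int[N]_x \int[N]_y f (x, y))%E.
Proof.
move=> ij iX mf f0; pose phi (b : bool) := if b then i else j.
have inj : injective phi.
  by move=> [] [] //; rewrite /phi => e; move: ij; rewrite e eqxx.
have mfw : mfunctional (fun w : bool -> R => f (w true, w false)).
  split=> // d1 T1 Z mZ; apply: measurableT_comp => //.
  by apply/measurable_fun_pairP; split; exact: mZ.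
rewrite (iid_normal_integral (iid_normal_comp inj iX) iid_normal_pair mfw) fubini_tonelli1//=.
by apply: eq_measurable_fun mf => -[].
Qed.
End iid_normal.

(** * Rotation invariance of Gaussian matrices *)

Section rotation_invariance.
Context {R : realType}.
Variable sigma : R.
Hypothesis sigma0 : sigma != 0.
Local Notation N := (normal_prob 0 sigma).
Local Notation iid := (iid_normal sigma).

Definition rotate_pair (I : eqType) (i j : I) (c s : R) (w : I -> R) : I -> R :=
  fun k => if k == i then c * w i - s * w j
           else if k == j then s * w i + c * w j else w k.

Lemma mfunctional_comp (I J : Type) (f : (I -> R) -> \bar R) (h : (J -> R) -> I -> R) :
  mfunctional f ->
  (forall d (T : measurableType d) (X : J -> T -> R), (forall j, measurable_fun setT (X j)) ->
    forall i, measurable_fun setT (fun t => h (X^~ t) i)) ->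
  mfunctional (fun w => f (h w)).
Proof.
move=> [f0 mf] mh; split=> // d T X mX.
exact: (mf _ _ (fun i t => h (X^~ t) i) (mh _ _ _ mX)).
Qed.

Lemma mfunctional_rotate_pair (I : eqType) (i j : I) (c s : R) (f : (I -> R) -> \bar R) :
  mfunctional f -> mfunctional (fun w => f (rotate_pair i j c s w)).
Proof.
move=> mf; apply: (mfunctional_comp mf) => d T X mX k; rewrite /rotate_pair.
case: (k == i); first by apply: measurable_funB; apply: measurable_funM.
by case: (k == j) => //; apply: measurable_funD; apply: measurable_funM.
Qed.

(** Resampling [i] and [j] alone freezes the other coordinates in the outer integral; the inner one
    is a planar Gaussian integral, to which the two-variable invariance applies. *)
Lemma iid_normal_rotate_pair d (T : measurableType d) (P : probability T R)
    (I : finType) (i j : I) (c s : R) (X : I -> T -> R) f :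
  i != j -> c ^+ 2 + s ^+ 2 = 1 -> -1 < c -> iid P X -> mfunctional f ->
  (\int[P]_t f (X^~ t) = \int[P]_t f (rotate_pair i j c s (X^~ t)))%E.
Proof.
move=> ij cs c1 iX mf; pose A k := (k != i) && (k != j).
have ji : (j == i) = false by rewrite eq_sym (negbTE ij).
have mf' := mfunctional_rotate_pair i j c s mf.
rewrite (iid_normal_resample A iX iX mf) (iid_normal_resample A iX iX mf').
apply: eq_integral => t _.
pose phi (z : R * R) := f (fun k => if k == i then z.1 else if k == j then z.2 else X k t).
have mphi : measurable_fun setT phi.
  apply: (mf.2 _ _ (fun k z => if k == i then z.1 else if k == j then z.2 else X k t)) => k.
  by case: (k == i); [exact: measurable_fst|case: (k == j); [exact: measurable_snd|]].
have phi0 z : (0 <= phi z)%E by exact: mf.1.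
have mixE t' : mix A X X t t' =
    fun k => if k == i then X i t' else if k == j then X j t' else X k t.
  apply/funext => k; rewrite /mix /A.
  by have [->|ki] := eqVneq k i; last have [->|kj] := eqVneq k j.
pose rho (z : R * R) := (c * z.1 - s * z.2, s * z.1 + c * z.2).
have mrho : measurable_fun setT rho.
  apply/measurable_fun_pairP; split => /=.
    by apply: measurable_funB; apply: measurable_funM.
  by apply: measurable_funD; apply: measurable_funM.
transitivity (\int[P]_t' phi (X i t', X j t'))%E.
  by apply: eq_integral => t' _; rewrite mixE.
transitivity (\int[P]_t' (phi \o rho) (X i t', X j t'))%E; last first.
  apply: eq_integral => t' _; rewrite mixE /phi /rho /= /rotate_pair; congr f.
  by apply/funext => k; rewrite !eqxx ji; case: (k == i); case: (k == j).
rewrite (iid_normal_integral2 ij iX mphi phi0).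
rewrite (iid_normal_integral2 ij iX (measurableT_comp mphi mrho) (fun z => phi0 _)).
by rewrite (ge0_integral_normal_rotation sigma0 cs c1 mphi phi0).
Qed.

Definition mxfunctional n m (F : 'M[R]_(n, m) -> \bar R) : Prop :=
  (forall A, (0 <= F A)%E) /\
  forall d (T : measurableType d) (A : T -> 'M[R]_(n, m)),
    (forall k l, measurable_fun setT (fun t => A t k l)) ->
    measurable_fun setT (fun t => F (A t)).

Lemma mxfunctional_mfunctional n m (F : 'M[R]_(n, m) -> \bar R) : mxfunctional F ->
  mfunctional (fun w : 'I_n * 'I_m -> R => F (\matrix_(k, l) w (k, l))).
Proof.
move=> [F0 mF]; split => // d T X mX; apply: mF => k l.
by under eq_fun do rewrite mxE; exact: mX.
Qed.

Lemma mxfunctional_comp n m p q (F : 'M[R]_(n, m) -> \bar R) (H : 'M[R]_(p, q) -> 'M[R]_(n, m)) :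
  mxfunctional F ->
  (forall d (T : measurableType d) (A : T -> 'M[R]_(p, q)),
    (forall k l, measurable_fun setT (fun t => A t k l)) ->
    forall k l, measurable_fun setT (fun t => H (A t) k l)) ->
  mxfunctional (fun A => F (H A)).
Proof. by move=> [F0 mF] mH; split => // d T A mA; apply: mF; exact: mH. Qed.

Lemma measurable_mulmx n m p d (T : measurableType d) (A : T -> 'M[R]_(n, m)) (B : T -> 'M[R]_(m, p)) :
  (forall k l, measurable_fun setT (fun t => A t k l)) ->
  (forall k l, measurable_fun setT (fun t => B t k l)) ->
  forall k l, measurable_fun setT (fun t => (A t *m B t) k l).
Proof.
move=> mA mB k l; under eq_fun do rewrite mxE.
by apply: measurable_sum => i; exact: measurable_funM.
Qed.

Lemma measurable_det n d (T : measurableType d) (A : T -> 'M[R]_n) :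
  (forall k l, measurable_fun setT (fun t => A t k l)) ->
  measurable_fun setT (fun t => \det (A t)).
Proof.
move=> mA; rewrite /determinant; apply: measurable_sum => s.
by apply: measurable_funM => //; apply: measurable_prod => i _; exact: mA.
Qed.

Lemma mxfunctional_mulmxr n m p (F : 'M[R]_(n, p) -> \bar R) (B : 'M[R]_(m, p)) :
  mxfunctional F -> mxfunctional (fun A => F (A *m B)).
Proof. by move=> mF; apply: (mxfunctional_comp mF) => d T A mA; exact: measurable_mulmx. Qed.

(** In each row only the entries in columns [i] and [j] are mixed, so the rows can be rotated one at
    a time, each by a rotation of two coordinates of the family. [part r] is the matrix whose rows
    in [r] have been rotated. *)
Lemma iid_normal_mul_planar_rotation d (T : measurableType d) (P : probability T R)
    n m (i j : 'I_m) (c s : R) (X : 'I_n * 'I_m -> T -> R) (F : 'M[R]_(n, m) -> \bar R) :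
  i != j -> c ^+ 2 + s ^+ 2 = 1 -> -1 < c -> iid P X -> mxfunctional F ->
  (\int[P]_t F (\matrix_(k, l) X (k, l) t) =
   \int[P]_t F (\matrix_(k, l) X (k, l) t *m planar_rotation i j c s))%E.
Proof.
move=> ij cs c1 iX mF.
pose part (r : seq 'I_n) (A : 'M[R]_(n, m)) : 'M[R]_(n, m) :=
  \matrix_(k, l) (if k \in r then (A *m planar_rotation i j c s) k l else A k l).
have mpart r : mxfunctional (fun A => F (part r A)).
  apply: (mxfunctional_comp mF) => d' T' A mA k l; under eq_fun do rewrite mxE.
  by case: (k \in r); [exact: (measurable_mulmx (B := fun=> planar_rotation i j c s))|exact: mA].
suff H r : uniq r -> (\int[P]_t F (\matrix_(k, l) X (k, l) t) =
    \int[P]_t F (part r (\matrix_(k, l) X (k, l) t)))%E.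
  rewrite (H (enum 'I_n)) ?enum_uniq//; apply: eq_integral => t _; congr F.
  by apply/matrixP => k l; rewrite mxE mem_enum.
elim: r => [_|k0 r IH /= /andP[k0r ur]].
  by apply: eq_integral => t _; congr F; apply/matrixP => k l; rewrite [in RHS]mxE.
rewrite IH//.
have kij : (k0, i) != (k0, j) by apply: contraNneq ij => -[->].
rewrite (iid_normal_rotate_pair kij cs c1 iX (mxfunctional_mfunctional (mpart r))).
apply: eq_integral => t _; congr F; apply/matrixP => k l.
rewrite [LHS]mxE [RHS]mxE inE !mulmx_planar_rotation// !mxE /rotate_pair !xpair_eqE !eqxx !andbT.
have [->|kk0] := eqVneq k k0; first by rewrite (negbTE k0r).
by case: (k \in r).
Qed.

Lemma iid_normal_mul_rotation d (T : measurableType d) (P : probability T R)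
    n m (Q : 'M[R]_m) (X : 'I_n * 'I_m -> T -> R) (F : 'M[R]_(n, m) -> \bar R) :
  rotation Q -> iid P X -> mxfunctional F ->
  (\int[P]_t F (\matrix_(k, l) X (k, l) t) =
   \int[P]_t F (\matrix_(k, l) X (k, l) t *m Q))%E.
Proof.
move=> gQ iX; elim: gQ F => [F _|{}Q i j c s _ IH ij cs c1 F mF].
  by apply: eq_integral => t _; rewrite mulmx1.
rewrite (iid_normal_mul_planar_rotation ij cs c1 iX mF).
rewrite (IH _ (mxfunctional_mulmxr (planar_rotation i j c s) mF)).
by apply: eq_integral => t _; rewrite mulmxA.
Qed.

Lemma iid_normal_tr_rotation_mul d (T : measurableType d) (P : probability T R)
    n m (Q : 'M[R]_n) (X : 'I_n * 'I_m -> T -> R) (F : 'M[R]_(n, m) -> \bar R) :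
  rotation Q -> iid P X -> mxfunctional F ->
  (\int[P]_t F (\matrix_(k, l) X (k, l) t) =
   \int[P]_t F (Q^T *m \matrix_(k, l) X (k, l) t))%E.
Proof.
move=> gQ iX mF.
have inj : injective (fun z : 'I_m * 'I_n => (z.2, z.1)) by move=> [? ?] [? ?] [-> ->].
have mFT : mxfunctional (fun A : 'M[R]_(m, n) => F A^T).
  by apply: (mxfunctional_comp mF) => d' T' A mA k l; under eq_fun do rewrite mxE; exact: mA.
have := iid_normal_mul_rotation gQ (iid_normal_comp inj iX) mFT.
have E t : (\matrix_(k, l) X (l, k) t)^T = \matrix_(k, l) X (k, l) t.
  by apply/matrixP => k l; rewrite !mxE.
under eq_integral do rewrite E; move=> ->.
by under eq_integral do rewrite trmx_mul E.
Qed.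

End rotation_invariance.

(** * Negative moments of chi-square variables and of Gaussian Gram determinants *)

Lemma probability_integral_cst (R : realType) d (T : measurableType d) (P : probability T R) (c : \bar R) :
  (\int[P]_t c = c)%E.
Proof. by rewrite integral_cst; [rewrite -[RHS]mule1; congr (_ * _)%E; exact: probability_setT|]. Qed.

Section laplace_measurable.
Context {R : realType}.

Definition laplace_kernel (a y u : R) : R := if 0 < u then u `^ (a - 1) * expR (- (u * y)) else 0.

Lemma laplace_kernel_ge0 a y u : 0 <= laplace_kernel a y u.
Proof. by rewrite /laplace_kernel; case: ifP => // _; rewrite mulr_ge0 ?powR_ge0 ?expR_ge0. Qed.

Lemma laplace_powR_kernel a y : laplace_powR a y = (\int[lebesgue_measure]_u (laplace_kernel a y u)%:E)%E.
Proof.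
rewrite /laplace_powR integral_mkcond; apply: eq_integral => u _.
by rewrite patch_posE /laplace_kernel; case: ifP.
Qed.

Lemma measurable_laplace_kernel a d (T : measurableType d) (f g : T -> R) :
  measurable_fun setT f -> measurable_fun setT g ->
  measurable_fun setT (fun t => (laplace_kernel a (f t) (g t))%:E).
Proof.
move=> mf mg; apply/measurable_EFinP; rewrite /laplace_kernel.
apply: measurable_fun_ifT; [|apply: measurable_funM|exact: measurable_cst].
- by apply: measurable_fun_ltr.
- exact: measurable_fun2_powR.
- by apply: measurableT_comp => //; apply: measurableT_comp => //; exact: measurable_funM.
Qed.

Lemma measurable_laplace_powR a : measurable_fun setT (@laplace_powR R a).
Proof.
have mk : measurable_fun setT (fun z : R * R => (laplace_kernel a z.1 z.2)%:E).
  by apply: measurable_laplace_kernel; [exact: measurable_fst|exact: measurable_snd].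
have k0 (z : R * R) : (0 <= (laplace_kernel a z.1 z.2)%:E)%E by rewrite lee_fin laplace_kernel_ge0.
rewrite (_ : laplace_powR a = fun y => (\int[lebesgue_measure]_u (laplace_kernel a y u)%:E)%E); last first.
  by apply/funext => y; rewrite laplace_powR_kernel.
exact: (@measurable_fun_fubini_tonelli_F _ _ _ _ _ (@lebesgue_measure R) _ mk k0).
Qed.

End laplace_measurable.

Section gamma_moments.
Context {R : realType}.
Variable sigma : R.
Hypothesis sigma0 : sigma != 0.
Local Notation N := (normal_prob 0 sigma).
Local Notation iid := (iid_normal sigma).

(** A product of one-dimensional Laplace transforms. The induction runs over lists in a fixed index
    type: resampling everything except [j] splits off one factor without changing the family. *)
Lemma iid_normal_expR_sumsqr d (T : measurableType d) (P : probability T R)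
    (J : finType) (X : J -> T -> R) (r : R) (s : seq J) : iid P X -> 0 <= r -> uniq s ->
  (\int[P]_t (expR (- (r * \sum_(j <- s) X j t ^+ 2)))%:E =
   (((1 + 2 * sigma ^+ 2 * r) `^ (- 2^-1)) ^+ size s)%:E)%E.
Proof.
move=> iX r0; elim: s => [_|j s IH /= /andP[js us]].
  under eq_integral do rewrite big_nil mulr0 oppr0 expR0.
  by rewrite probability_integral_cst expr0.
set c := _ `^ _ in IH *.
have mf : mfunctional (fun w : J -> R => (expR (- (r * \sum_(j <- j :: s) w j ^+ 2)))%:E).
  split=> [w|d' T' Y mY]; first by rewrite lee_fin expR_ge0.
  apply/measurable_EFinP; apply: measurableT_comp => //; apply: measurableT_comp => //.
  apply: measurable_funM => //; apply: measurable_sum => i; exact: measurable_funX.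
rewrite (iid_normal_resample (pred1 j) iX iX mf).
have c0 : 0 <= c by exact: powR_ge0.
have mE (k : J -> T -> R) : (forall j, measurable_fun setT (k j)) ->
    measurable_fun setT (fun t => (expR (- (r * \sum_(j <- s) k j t ^+ 2)))%:E).
  move=> mk; apply/measurable_EFinP; apply: measurableT_comp => //; apply: measurableT_comp => //.
  apply: measurable_funM => //; apply: measurable_sum => i; exact: measurable_funX.
transitivity (\int[P]_t ((expR (- (r * X j t ^+ 2)))%:E * (c ^+ size s)%:E))%E.
  apply: eq_integral => t _; rewrite -(IH us) -ge0_integralZl//; try by [apply: mE; exact: iX.1|move=> t' _; rewrite lee_fin expR_ge0|rewrite lee_fin expR_ge0].
  apply: eq_integral => t' _; rewrite big_cons -EFinM -expRD; congr (expR _)%:E.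
  rewrite mulrDr opprD /mix /= eqxx; congr (_ - _ * _); apply: eq_big_seq => i is_.
  by case: eqP => // ij; move: js; rewrite -ij is_.
have m1 : measurable_fun setT (fun x : R => (expR (- (r * x ^+ 2)))%:E).
  apply/measurable_EFinP; apply: measurableT_comp => //; apply: measurableT_comp => //.
  by apply: measurable_funM => //; exact: measurable_funX.
have mXj : measurable_fun setT (fun t => (expR (- (r * X j t ^+ 2)))%:E).
  exact: (measurableT_comp m1 (iX.1 j)).
rewrite ge0_integralZr//; try by [move=> t _; rewrite lee_fin expR_ge0|rewrite lee_fin exprn_ge0].
have p1 (x : R) : (0 <= (expR (- (r * x ^+ 2)))%:E)%E by rewrite lee_fin expR_ge0.
by rewrite (iid_normal_integral1 j iX m1 p1) laplace_sqr_normal_prob// -EFinM [in RHS]exprS.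
Qed.

(* The moment of order [-a] of [sigma^2] times a chi-square variable with [2b]
   degrees of freedom. *)
Definition gamma_ratio (a b : R) : R := (2 * sigma ^+ 2) `^ (- a) * (Gamma (b - a) / Gamma b).

Lemma gamma_ratio_ge0 (a b : R) : a < b -> 0 < b -> 0 <= gamma_ratio a b.
Proof.
move=> ab b0; rewrite /gamma_ratio mulr_ge0 ?powR_ge0//.
by rewrite divr_ge0// ltW// Gamma_gt0// subr_gt0.
Qed.

(** With the integrals exchanged, the Laplace transform of the sum of squares leaves (1 + 2 sigma^2
    u D)^(-b) with b = #|J| / 2, integrated by the Beta formula, which asks a < b. At D = 0 both
    sides are infinite. *)
Lemma iid_normal_laplace_sumsqr d (T : measurableType d) (P : probability T R)
    (J : finType) (X : J -> T -> R) (a D : R) : iid P X -> 0 < a -> a < #|J|%:R / 2 -> 0 <= D ->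
  (\int[P]_t laplace_powR a (D * \sum_j X j t ^+ 2) =
   (gamma_ratio a (#|J|%:R / 2))%:E * laplace_powR a D)%E.
Proof.
move=> iX a0 aJ D0.
have s2 : 0 < 2 * sigma ^+ 2 by rewrite mulr_gt0// exprn_even_gt0.
pose S t := D * \sum_j X j t ^+ 2.
have mS : measurable_fun setT S.
  apply: measurable_funM => //; apply: measurable_sum => i; apply: measurable_funX; exact: iX.1.
have mk : measurable_fun setT (fun z : T * R => (laplace_kernel a (S z.1) z.2)%:E).
  apply: measurable_laplace_kernel; last exact: measurable_snd.
  by apply: measurableT_comp mS _; exact: measurable_fst.
have k0 (z : T * R) : (0 <= (laplace_kernel a (S z.1) z.2)%:E)%E by rewrite lee_fin laplace_kernel_ge0.
transitivity (\int[P]_t \int[lebesgue_measure]_u (laplace_kernel a (S t) u)%:E)%E.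
  by apply: eq_integral => t _; rewrite laplace_powR_kernel.
rewrite (@fubini_tonelli _ _ _ _ _ P (@lebesgue_measure R) _ mk k0) /=.
transitivity (\int[lebesgue_measure]_(u in [set u : R | (0 < u)%R])
   (u `^ (a - 1) * (1 + u * (2 * sigma ^+ 2 * D)) `^ (- (#|J|%:R / 2)))%:E)%E; last first.
  rewrite integral_powR_1DM//; last by rewrite mulr_ge0// ltW.
  by rewrite laplace_powRM// muleA -EFinM /gamma_ratio mulrC.
rewrite [RHS]integral_mkcond; apply: eq_integral => u _; rewrite patch_posE /laplace_kernel.
case: ifPn => u0; last by rewrite integral0_eq.
under eq_integral do rewrite EFinM.
have uD : 0 <= u * D by rewrite mulr_ge0// ltW.
have mexp : measurable_fun setT (fun t => (expR (- (u * S t)))%:E).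
  apply/measurable_EFinP; apply: measurableT_comp => //; apply: measurableT_comp => //.
  exact: measurable_funM.
rewrite ge0_integralZl//; try by [move=> t _; rewrite lee_fin expR_ge0|rewrite lee_fin powR_ge0].
under eq_integral do rewrite /S mulrA.
have us : uniq (enum J) := enum_uniq J.
have -> : (\int[P]_t (expR (- (u * D * \sum_j X j t ^+ 2)))%:E =
   \int[P]_t (expR (- (u * D * \sum_(j <- enum J) X j t ^+ 2)))%:E)%E.
  by apply: eq_integral => t _; rewrite big_enum.
rewrite (iid_normal_expR_sumsqr iX uD us) -cardE -EFinM; congr (_ * _)%:E.
rewrite -powR_mulrn ?powR_ge0// -powRrM; congr (_ `^ _); first by ring.
by ring.
Qed.

End gamma_moments.

Section wishart.
Context {R : realType}.
Variable sigma : R.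
Hypothesis sigma0 : sigma != 0.
Local Notation iid := (iid_normal sigma).

Lemma mxfunctional_laplace_gram n m p q (a c : R) (H : 'M[R]_(p, q) -> 'M[R]_(n, m)) :
  (forall d (T : measurableType d) (A : T -> 'M[R]_(p, q)),
    (forall k l, measurable_fun setT (fun t => A t k l)) ->
    forall k l, measurable_fun setT (fun t => H (A t) k l)) ->
  mxfunctional (fun A => laplace_powR a (c * \det (H A *m (H A)^T))).
Proof.
move=> mH; split=> [A|d T A mA]; first exact: laplace_powR_ge0.
apply: measurableT_comp (measurable_laplace_powR a) _.
apply: measurable_funM => //; apply: measurable_det; apply: measurable_mulmx.
  exact: mH.
by move=> k l; under eq_fun do rewrite mxE; exact: mH.
Qed.

Lemma iid_normal_laplace_gram d (T : measurableType d) (P : probability T R) n m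
    (X : 'I_n * 'I_m -> T -> R) (a : R) : iid P X -> (n <= m)%N -> 0 < a -> a < 2^-1 ->
  (\int[P]_t laplace_powR a
     (\det ((\matrix_(k, l) X (k, l) t) *m (\matrix_(k, l) X (k, l) t)^T)) =
   (Gamma a * \prod_(0 <= i < n) gamma_ratio sigma a ((m - i)%:R / 2))%:E)%E.
Proof.
move=> + + a0 a2; elim: n m X => [|n IH] m X iX nm.
  under eq_integral do rewrite det_mx00.
  by rewrite probability_integral_cst laplace_powR1// big_geq// mulr1.
case: m X iX nm => [//|m] X iX nm.
pose mx t := \matrix_(k < 1 + n, l < 1 + m) X (k, l) t.
pose F (A : 'M[R]_(1 + n, 1 + m)) := laplace_powR a (\det (A *m A^T)).
have mF : mxfunctional F.
  have := @mxfunctional_laplace_gram _ _ _ _ a 1 (fun A : 'M[R]_(1 + n, 1 + m) => A).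
  rewrite (_ : (fun A => _) = F); first by apply.
  by apply/funext => A; rewrite mul1r.
(* The first row stays with the outer variable and all others are resampled, so the inner integral
   sees it as a constant vector. *)
pose A0 (z : 'I_(1 + n) * 'I_(1 + m)) := z.1 == 0.
rewrite (iid_normal_resample A0 iX iX (mxfunctional_mfunctional mF)).
pose Xr (l : 'I_(1 + m)) t := X (0, l) t.
pose Xd (z : 'I_n * 'I_m) t := X (lift 0 z.1, lift 0 z.2) t.
have iXr : iid P Xr by apply: iid_normal_comp iX => l l' /pair_equal_spec [].
have iXd : iid P Xd.
  by apply: iid_normal_comp iX => -[k l] [k' l'] /= /pair_equal_spec [/lift_inj -> /lift_inj ->].
pose dd t := \det ((\matrix_(k, l) Xd (k, l) t) *m (\matrix_(k, l) Xd (k, l) t)^T).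
have dd0 t : 0 <= dd t by exact: det_gram_ge0.
have ddE t : dd t = \det (drsubmx (mx t) *m (drsubmx (mx t))^T).
  rewrite /dd; congr (\det (_ *m _^T)); apply/matrixP => k l; rewrite !mxE /Xd;
  by congr (X (_, _) t); apply/val_inj.
(* Rotate the resampled rows along with the row [x] fixed by the outer integral. *)
have inner t : (\int[P]_t' F (\matrix_(k, l) mix A0 X X t t' (k, l)) =
    \int[P]_t' laplace_powR a ((\sum_l Xr l t ^+ 2) * dd t'))%E.
  pose x : 'rV[R]_(1 + m) := \row_l Xr l t.
  have [Q [z [gQ xQ z2]]] := rotation_to_axis x.
  pose G (y : 'rV[R]_(1 + m)) (A : 'M[R]_(1 + n, 1 + m)) : \bar R :=
    F (col_mx y (dsubmx A)).
  have mG y : mxfunctional (G y).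
    apply: (mxfunctional_comp mF) => d' T' A mA k l; under eq_fun do rewrite mxE.
    by case: (fintype.split k) => k'; [exact: measurable_cst|under eq_fun do rewrite mxE; exact: mA].
  have mixE t' : \matrix_(k, l) mix A0 X X t t' (k, l) = col_mx x (dsubmx (mx t')).
    apply/matrixP => k l; rewrite !mxE /mix /A0; case: splitP => k' kk'.
      have -> : k = 0 by apply/val_inj; rewrite /= kk' ord1.
      by rewrite eqxx !mxE.
    rewrite !mxE ifF; first by congr (X (_, _) t'); apply/val_inj.
    by apply/negP => /eqP /= k0; move: kk'; rewrite k0.
  transitivity (\int[P]_t' G x (mx t'))%E.
    by apply: eq_integral => t' _; rewrite mixE.
  transitivity (\int[P]_t' G (row_mx z%:M 0) (mx t' *m Q))%E.
    apply: eq_integral => t' _; rewrite /G /F -(gram_rotation (col_mx x _) gQ).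
    by rewrite mul_col_mx xQ mul_dsub_mx.
  rewrite -(iid_normal_mul_rotation sigma0 gQ iX (mG _)).
  apply: eq_integral => t' _; rewrite /G /F.
  have -> : col_mx (row_mx z%:M 0) (dsubmx (mx t')) =
      block_mx z%:M 0 (dlsubmx (mx t')) (drsubmx (mx t')).
    by rewrite /block_mx -[dsubmx (mx t')]hsubmxK.
  have xE : \sum_l x 0 l ^+ 2 = \sum_l Xr l t ^+ 2 by apply: eq_bigr => l _; rewrite mxE.
  by rewrite ddE det_gram_lblock z2 xE.
under eq_integral => t _ do rewrite inner.
have mdd : measurable_fun setT dd.
  apply: measurable_det; apply: measurable_mulmx => k l; under eq_fun do rewrite !mxE; exact: iXd.1.
have mR : measurable_fun setT (fun t => \sum_l Xr l t ^+ 2).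
  by apply: measurable_sum => l; apply: measurable_funX; exact: iXr.1.
have mk : measurable_fun setT (fun z : T * T => laplace_powR a ((\sum_l Xr l z.1 ^+ 2) * dd z.2)).
  apply: measurableT_comp (measurable_laplace_powR a) _; apply: measurable_funM.
    by apply: measurableT_comp mR _; exact: measurable_fst.
  by apply: measurableT_comp mdd _; exact: measurable_snd.
(* Now the first row is integrated at a fixed value of the remaining Gram determinant, possibly 0;
   it yields the ratio with 1 + m degrees of freedom. *)
rewrite (@fubini_tonelli _ _ _ _ _ P P _ mk (fun z => laplace_powR_ge0 _ _)) /=.
have aJ : a < #|'I_(1 + m)|%:R / 2.
  rewrite card_ord; apply: (lt_le_trans a2); rewrite -[leLHS]mul1r ler_wpM2r//.
  by rewrite ler1n.
under eq_integral.
  move=> t' _; under eq_integral do rewrite mulrC.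
  rewrite (iid_normal_laplace_sumsqr sigma0 iXr a0 aJ (dd0 t')) card_ord; over.
have mLd : measurable_fun setT (fun t => laplace_powR a (dd t)).
  exact: measurableT_comp (measurable_laplace_powR a) mdd.
have gr0 : 0 <= gamma_ratio sigma a ((1 + m)%:R / 2).
  by apply: gamma_ratio_ge0; [move: aJ; rewrite card_ord|rewrite divr_gt0].
rewrite ge0_integralZl//; try by [move=> t' _; exact: laplace_powR_ge0|rewrite lee_fin].
rewrite (IH m Xd iXd nm) -EFinM big_nat_recl//= subn0 mulrCA; congr (_ * (_ * _))%:E; by apply: eq_big_nat.
Qed.
End wishart.

(** * Jensen's inequality for the log-sum, from negative moments *)

Lemma ln_1Dsum_tangent (R : realType) (J : finType) (p e y : J -> R)
    (D := 1 + \sum_j p j * e j) :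
  (forall j, 0 <= p j) -> (forall j, 0 < e j) -> (forall j, 0 < p j -> 0 < y j) ->
  (forall j, 0 <= y j) ->
  ln D + \sum_j p j * e j / D * (ln (y j) - ln (e j)) <= ln (1 + \sum_j p j * y j).
Proof.
move=> p0 e0 py y0; pose D' := 1 + \sum_j p j * y j.
have D0 : 0 < D by rewrite /D ltr_wpDr// sumr_ge0// => j _; rewrite mulr_ge0// ltW.
have D'0 : 0 < D' by rewrite /D' ltr_wpDr// sumr_ge0// => j _; rewrite mulr_ge0.
have lnle (z : R) : 0 < z -> ln z <= z - 1.
  by move=> z0; have := @le_ln1Dx R (z - 1); rewrite [1 + _]addrC subrK; apply; lra.
(* Gibbs' inequality, termwise: the weights 1 / D and p_j e_j / D sum to 1, and so do 1 / D' and p_j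
   y_j / D'. Each term of the relative entropy is bounded by ln z <= z - 1 at the ratio of the two
   weights; [base] is the term of the constant 1. *)
have main j : p j * e j / D * (ln (y j) - ln (e j) + (ln D - ln D')) <=
    p j * y j / D' - p j * e j / D.
  have [pj|pj] := ltP 0 (p j); last first.
    have -> : p j = 0 by apply/eqP; rewrite eq_le pj p0.
    by rewrite !mul0r subrr.
  have yj := py j pj.
  have -> : ln (y j) - ln (e j) + (ln D - ln D') = ln (y j / e j * (D / D')).
    by rewrite lnM ?posrE ?divr_gt0// !ln_div ?posrE.
  apply: (@le_trans _ _ (p j * e j / D * (y j / e j * (D / D') - 1))).
    have k0 : 0 <= p j * e j / D by apply/ltW/divr_gt0/D0/mulr_gt0/e0/pj.
    by rewrite (ler_wpM2l k0)// lnle// mulr_gt0// divr_gt0.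
  rewrite le_eqVlt; apply/orP; left; apply/eqP; field.
  by rewrite !gt_eqF ?e0.
have base : D^-1 * (ln D - ln D') <= D'^-1 - D^-1.
  rewrite -ln_div ?posrE//; apply: (@le_trans _ _ (D^-1 * (D / D' - 1))).
    by rewrite ler_wpM2l ?lnle ?divr_gt0// invr_ge0 ltW.
  rewrite le_eqVlt; apply/orP; left; apply/eqP; field.
  by rewrite !gt_eqF.
have S : \sum_j p j * e j / D * (ln (y j) - ln (e j) + (ln D - ln D')) <=
    \sum_j (p j * y j / D' - p j * e j / D) by apply: ler_sum => j _; exact: main.
have := lerD base S.
rewrite sumrB -!mulr_suml.
have -> : D'^-1 - D^-1 + ((\sum_j p j * y j) / D' - (\sum_j p j * e j) / D) = 0.
  have -> : \sum_j p j * y j = D' - 1 by rewrite /D' addrC addKr.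
  have -> : \sum_j p j * e j = D - 1 by rewrite /D addrC addKr.
  by field; rewrite !gt_eqF.
under eq_bigr do rewrite mulrDr.
rewrite big_split /= -mulr_suml -mulr_suml.
have -> : \sum_j p j * e j = D - 1 by rewrite /D addrC addKr.
have -> : forall S, D^-1 * (ln D - ln D') + (S + (D - 1) / D * (ln D - ln D')) = S + ln D - ln D'.
  by move=> S'; field; rewrite gt_eqF.
by rewrite subr_le0 addrC.
Qed.

(** [l j] plays the part of the mean of ln (Y j), known only as minus the derivative at 0 of the
    negative moments [M j]; nothing is asked of the joint law of the [Y j]. *)
Lemma le_integral_ln_1Dsum (R : realType) d (T : measurableType d) (P : probability T R)
    (J : finType) (p l : J -> R) (Y : J -> T -> R) (M : J -> R -> R) (a0 : R) :
  0 < a0 -> (forall j, 0 <= p j) ->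
  (forall j, measurable_fun setT (Y j)) -> (forall j t, 0 <= Y j t) ->
  (forall j a, 0 < a -> a < a0 ->
    (\int[P]_t laplace_powR a (Y j t) = (Gamma a * M j a)%:E)%E) ->
  (forall j, M j 0 = 1) -> (forall j, is_derive (0 : R) 1 (M j) (- l j)) ->
  ((ln (1 + \sum_j p j * expR (l j)))%:E <=
    \int[P]_t (ln (1 + \sum_j p j * Y j t))%:E)%E.
Proof.
move=> a00 p0 mY Y0 EY M0 dM.
pose D := 1 + \sum_j p j * expR (l j).
have D0 : 0 < D by rewrite /D ltr_wpDr// sumr_ge0// => j _; rewrite mulr_ge0// expR_ge0.
pose w j := p j * expR (l j) / D.
have w0 j : 0 <= w j by rewrite /w divr_ge0 ?mulr_ge0 ?expR_ge0// ltW.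
pose V t := ln (1 + \sum_j p j * Y j t).
have V0 t : 0 <= V t.
  by rewrite /V ln_ge0// lerDl sumr_ge0// => j _; rewrite mulr_ge0.
have mV : measurable_fun setT V.
  apply: measurableT_comp => //; apply: measurable_funD => //.
  by apply: measurable_sum => j; exact: measurable_funM.
(* [M j] are the negative moments; as [a -> 0+], [Y^(-a) >= 1 - a ln Y] turns the
   tangent inequality at [l] into [C a <= V + sum_j w_j Y_j^(-a) / a]. *)
pose C a := ln D + \sum_j w j * (a^-1 - l j).
have key a : 0 < a -> a < a0 -> ((C a)%:E <= \int[P]_t (V t)%:E +
    (\sum_j w j * M j a / a)%:E)%E.
  move=> a_gt0 aa0; have Ga := Gamma_gt0 a_gt0.
  (* Normalized so that [k j] times the Laplace integral is w_j Y_j^(-a) / a wherever Y_j > 0. *)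
  pose k j := w j / (a * Gamma a).
  have k0 j : 0 <= k j by rewrite /k divr_ge0// mulr_ge0// ltW.
  (* [C a] may be negative; the maximum with 0 keeps the comparison among nonnegative integrands. *)
  have pt t : ((Num.max (C a) 0)%:E <=
      (V t)%:E + \sum_j (k j)%:E * laplace_powR a (Y j t))%E.
    have S0 : (0 <= \sum_j (k j)%:E * laplace_powR a (Y j t))%E.
      by apply: sume_ge0 => j _; rewrite mule_ge0 ?lee_fin// laplace_powR_ge0.
    have [Ca0|Ca0] := leP (C a) 0; first by rewrite adde_ge0 ?lee_fin.
    have [[j [pj Yj]]|nex] := pselect (exists j, 0 < p j /\ Y j t = 0).
      rewrite (bigD1 j)//= Yj laplace_powR0// gt0_muley; last first.
        by rewrite lte_fin /k /w !divr_gt0// ?mulr_gt0 ?expR_gt0.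
      set rest := (X in (_ + (_ + X))%E).
      have rest0 : (0 <= rest)%E.
        by apply: sume_ge0 => i _; rewrite mule_ge0 ?lee_fin// laplace_powR_ge0.
      by rewrite addye ?leey// gt_eqF// (lt_le_trans _ rest0).
    have Yp j : 0 < p j -> 0 < Y j t.
      move=> pj; rewrite lt_neqAle Y0 andbT eq_sym; apply/eqP => Yj.
      by apply: nex; exists j.
    have tang := ln_1Dsum_tangent p0 (fun j => expR_gt0 (l j)) Yp (Y0 ^~ t).
    apply: (@le_trans _ _ ((V t)%:E + (\sum_j w j / a * (1 - a * ln (Y j t)))%:E)%E).
      rewrite -EFinD lee_fin /C.
      have -> : \sum_j w j / a * (1 - a * ln (Y j t)) = \sum_j w j * (a^-1 - l j) -
          \sum_j w j * (ln (Y j t) - ln (expR (l j))).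
        rewrite -sumrB; apply: eq_bigr => j _; rewrite expRK; field.
        by rewrite gt_eqF.
      move: tang; rewrite -/D -/(V t) /= => tang.
      rewrite /w; lra.
    apply: leeD => //; rewrite -sumEFin; apply: lee_sum => j _.
    have [pj|pj] := ltP 0 (p j); last first.
      have pj0 : p j = 0 by apply/eqP; rewrite eq_le pj p0.
      by rewrite /k /w pj0 !mul0r mul0e.
    apply: (@le_trans _ _ ((k j)%:E * (Gamma a * (1 - a * ln (Y j t)))%:E)%E).
      rewrite -EFinM lee_fin /k le_eqVlt; apply/orP; left; apply/eqP; field.
      by rewrite !gt_eqF.
    by rewrite lee_wpmul2l ?lee_fin// le_laplace_powR// Yp.
  have mL j : measurable_fun setT (fun t => (k j)%:E * laplace_powR a (Y j t))%E.
    by apply: measurable_funeM; apply: measurableT_comp (measurable_laplace_powR a) (mY j).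
  have L0 j t : (0 <= (k j)%:E * laplace_powR a (Y j t))%E.
    by rewrite mule_ge0 ?lee_fin// laplace_powR_ge0.
  have mVE : measurable_fun setT (fun t => (V t)%:E) by exact/measurable_EFinP.
  have mSL : measurable_fun setT (fun t => \sum_j (k j)%:E * laplace_powR a (Y j t))%E.
    exact: emeasurable_sum.
  apply: (@le_trans _ _ (Num.max (C a) 0)%:E); first by rewrite lee_fin le_max lexx.
  rewrite -[leLHS](probability_integral_cst P).
  apply: (@le_trans _ _ (\int[P]_t ((V t)%:E + \sum_j (k j)%:E * laplace_powR a (Y j t)))%E).
    apply: ge0_le_integral => //.
    - by move=> t _; rewrite lee_fin le_max lexx orbT.
    - exact: emeasurable_funD.
  rewrite ge0_integralD//; last 2 first.
  - by move=> t _; rewrite lee_fin.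
  - by move=> t _; apply: sume_ge0.
  rewrite leeD2l// ge0_integral_sum//.
  rewrite -sumEFin le_eqVlt; apply/orP; left; apply/eqP; apply: eq_bigr => j _.
  rewrite ge0_integralZl//; last 3 first.
  - by apply: measurableT_comp (measurable_laplace_powR a) (mY j).
  - by move=> t _; exact: laplace_powR_ge0.
  - by rewrite lee_fin.
  rewrite EY// -EFinM /k; congr (_%:E); field.
  by rewrite !gt_eqF.
have I0 : (0 <= \int[P]_t (V t)%:E)%E by apply: integral_ge0 => t _; rewrite lee_fin.
rewrite -/D -/(V _).
have [Ioo|Ifin] := eqVneq (\int[P]_t (V t)%:E)%E +oo%E; first by rewrite Ioo leey.
have /fineK rE : (\int[P]_t (V t)%:E)%E \is a fin_num.
  by rewrite ge0_fin_numE// lt_neqAle Ifin leey.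
move: rE key; set r := fine _ => <- key.
rewrite lee_fin.
apply/ler_addgt0Pr => eps eps0.
have cq j : h^-1 *: (M j (h + 0) - M j 0) @[h --> 0^'] --> - l j.
  have [dv E] := dM j; rewrite -E.
  rewrite (_ : (fun h => _) = (fun h => h^-1 *: ((M j \o shift 0) (h *: 1) - M j 0))); first exact: dv.
  by apply/funext => h; rewrite /= scaler1.
have W0 : 0 < 1 + \sum_j w j by rewrite ltr_wpDr// sumr_ge0.
(* The 1 in the denominator avoids a division by 0 when all weights vanish, and still gives
   [\sum_j w j * eta <= eps]. *)
pose eta := eps / (1 + \sum_j w j).
have eta0 : 0 < eta by rewrite divr_gt0.
have nq : \forall h \near 0^'+, forall j, `|- l j - h^-1 *: (M j (h + 0) - M j 0)| <= eta.
  apply: filter_forall => j.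
  have : h^-1 *: (M j (h + 0) - M j 0) @[h --> 0^'+] --> - l j.
    apply: cvg_trans (cq j); apply: cvg_app => A [e e0 eA]; exists e => // x xe x0.
    by apply: eA => //; rewrite gt_eqF.
  by move=> /cvgrPdist_le /(_ _ eta0).
near (0 : R)^'+ => h.
have h0 : 0 < h by near: h; exact: nbhs_right_gt.
have ha0 : h < a0 by near: h; exact: nbhs_right_lt.
have hq j : `|- l j - h^-1 *: (M j (h + 0) - M j 0)| <= eta by move: j; near: h.
have := key h h0 ha0; rewrite -EFinD lee_fin => keyh.
apply: (@le_trans _ _ (ln D)) => //.
(* As [M j 0 = 1], each bracket is the difference quotient of [M j] at 0 plus [l j], which tends to
   0: the diverging terms 1 / h cancel. *)
have E : ln D - r <= \sum_j w j * (M j h / h - (h^-1 - l j)).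
  rewrite (_ : \sum_j _ = \sum_j w j * M j h / h - \sum_j w j * (h^-1 - l j)).
    by move: keyh; rewrite /C; lra.
  by rewrite -sumrB; apply: eq_bigr => j _; ring.
rewrite -lerBlDl; apply: (le_trans E).
apply: (@le_trans _ _ (\sum_j w j * eta)).
  apply: ler_sum => j _; rewrite ler_wpM2l//.
  have := hq j; rewrite addr0 M0 ler_norml => /andP[+ _].
  rewrite /GRing.scale /= mulrBr mulr1 [h^-1 * M j h]mulrC; lra.
rewrite -mulr_suml /eta mulrCA; apply: ler_piMr; first exact: ltW.
by rewrite ler_pdivrMr// mul1r lerDr.
Unshelve. all: by end_near. Qed.

(** * Sums over minors and logarithmic derivatives at 0 *)

Lemma sum_set_card (V : zmodType) m (F : nat -> V) :
  \sum_(S : {set 'I_m}) F #|S| = \sum_(0 <= n < m.+1) F n *+ 'C(m, n).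
Proof.
rewrite big_mkord (partition_big (fun S : {set 'I_m} => inord #|S| : 'I_m.+1) predT)//=.
apply: eq_bigr => n _.
have cm (S : {set 'I_m}) : (#|S| < m.+1)%N by rewrite ltnS -[leqRHS]card_ord max_card.
transitivity (\sum_(S : {set 'I_m} | #|S| == n) F n).
  apply: eq_big => S; first by rewrite -val_eqE /= inordK.
  by move=> /eqP <-; rewrite inordK.
transitivity (F n *+ \sum_(S : {set 'I_m} | #|S| == n) 1).
  by rewrite -sumrMnr.
by congr (_ *+ _); rewrite sum1dep_card card_draws card_ord.
Qed.

Lemma sum_set_weighted (R : realType) m M (c : R) (q : nat -> R) :
  \sum_(S : {set 'I_m}) (if #|S| == 0%N then 0 else
    c ^+ #|S| * \prod_(0 <= k < #|S|) (kdelta k * (#|S| * M)%:R + q k)) =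
  \sum_(1 <= n < m.+1) c ^+ n * 'C(m, n)%:R * \prod_(0 <= k < n) (kdelta k * (n * M)%:R + q k).
Proof.
pose f (n : nat) : R := if n == 0%N then 0 else
  c ^+ n * \prod_(0 <= k < n) (kdelta k * (n * M)%:R + q k).
rewrite (sum_set_card _ f) big_ltn// {1}/f eqxx mul0rn add0r.
apply: eq_big_nat => n /andP[n0 _]; rewrite /f gtn_eqF//.
by rewrite -[LHS]mulr_natr [LHS]mulrAC.
Qed.

(** Only the factor k = 0 is altered, so the product of the bound splits into two terms, one for
    each summand of a principal minor. *)
Lemma prod_kdelta (R : realType) n (x : R) (q : nat -> R) : (0 < n)%N ->
  \prod_(0 <= k < n) (kdelta k * x + q k) =
  x * \prod_(1 <= k < n) q k + \prod_(0 <= k < n) q k.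
Proof.
move=> n0; rewrite !(big_ltn n0) /kdelta eqxx mul1r.
rewrite (eq_big_nat _ _ (F2 := q)); first by rewrite mulrDl.
by move=> k /andP[k0 _]; rewrite (gtn_eqF k0) mul0r add0r.
Qed.

Lemma is_derive_prod1 (R : realType) (I : eqType) (s : seq I) (f : I -> R -> R) (l : I -> R) :
  (forall i, i \in s -> f i 0 = 1) -> (forall i, i \in s -> is_derive (0 : R) 1 (f i) (- l i)) ->
  is_derive (0 : R) 1 (fun a => \prod_(i <- s) f i a) (- \sum_(i <- s) l i).
Proof.
elim: s => [|i s IH] f1 df.
  rewrite big_nil oppr0 (_ : (fun _ => _) = cst 1); first exact: is_derive_cst.
  by apply/funext => a; rewrite big_nil.
have IHs : is_derive (0 : R) 1 (fun a => \prod_(i <- s) f i a) (- \sum_(i <- s) l i).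
  by apply: IH => j js; [apply: f1|apply: df]; rewrite inE js orbT.
have fs0 : \prod_(i <- s) f i 0 = 1.
  by rewrite big1_seq// => j /andP[_ js]; rewrite f1// inE js orbT.
rewrite (_ : (fun _ => _) = f i * (fun a => \prod_(i <- s) f i a)); last first.
  by apply/funext => a; rewrite big_cons.
have dfi := df i (mem_head _ _).
have := is_deriveM dfi IHs; rewrite fs0 f1 ?mem_head// !scale1r big_cons opprD addrC.
exact.
Qed.

Section gamma_ratio.
Context {R : realType}.
Variable sigma : R.
Hypothesis sigma0 : sigma != 0.

Lemma gamma_ratio0 b : 0 < b -> gamma_ratio sigma 0 b = 1.
Proof. by move=> b0; rewrite /gamma_ratio oppr0 powRr0 mul1r addr0 divff// gt_eqF// Gamma_gt0. Qed.

(** Minus this derivative is the mean logarithm of sigma^2 times a chi-square variable with 2 b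
    degrees of freedom; its exponential is the factor 2 sigma^2 e^(psi(b)) of the bound. *)
Lemma is_derive_gamma_ratio b : 0 < b ->
  is_derive (0 : R) 1 (gamma_ratio sigma ^~ b) (- (ln (2 * sigma ^+ 2) + digamma b)).
Proof.
move=> b0; have s2 : 0 < 2 * sigma ^+ 2 by rewrite mulr_gt0// exprn_even_gt0.
have Gb := Gamma_gt0 b0.
have dG : is_derive b 1 (@Gamma R) ('D_1 (@Gamma R) b) by apply: DeriveDef => //; exact: derivable_Gamma.
have dG0 : is_derive (b - 0) 1 (@Gamma R) ('D_1 (@Gamma R) b) by rewrite subr0.
have db : is_derive (0 : R) 1 (fun a : R => b - a) (- 1).
  by apply: is_derive_eq; rewrite ?sub0r ?add0r mul1r.
have d1 : is_derive (0 : R) 1 (fun a : R => Gamma (b - a)) ('D_1 (@Gamma R) b * - 1).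
  exact: (@is_derive1_comp _ (@Gamma R) (fun a : R => b - a) 0 _ _ dG0 db).
have d2 : is_derive (0 : R) 1 (fun a : R => (2 * sigma ^+ 2) `^ (- a)) (- ln (2 * sigma ^+ 2)).
  rewrite (_ : (fun _ => _) = (fun a : R => expR (- ln (2 * sigma ^+ 2) * a))); last first.
    by apply/funext => a; rewrite /powR gt_eqF// mulNr mulNr mulrC.
  have dl : is_derive (0 : R) 1 (fun a : R => - ln (2 * sigma ^+ 2) * a) (- ln (2 * sigma ^+ 2)).
    rewrite (_ : (fun _ => _) = (fun a : R => - ln (2 * sigma ^+ 2) *: a))//.
    by apply: is_derive_eq; rewrite scaler1.
  have de : is_derive (- ln (2 * sigma ^+ 2) * 0 : R) 1 (@expR R) 1.
    by rewrite mulr0; apply: is_derive_eq; rewrite expR0.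
  have := @is_derive1_comp _ (@expR R) (fun a : R => - ln (2 * sigma ^+ 2) * a) 0 _ _ de dl.
  by rewrite mul1r.
rewrite (_ : gamma_ratio sigma ^~ b = (fun a : R => (2 * sigma ^+ 2) `^ (- a)) *
    ((Gamma b)^-1 *: (fun a : R => Gamma (b - a)))); last first.
  by apply/funext => a; rewrite /gamma_ratio; congr (_ * _); rewrite mulrC.
apply: is_derive_eq.
rewrite oppr0 powRr0 scale1r /digamma derive1E.
have -> : ((Gamma b)^-1 *: (fun a : R => Gamma (b - a))) 0 = 1.
  by rewrite -[LHS]/((Gamma b)^-1 * Gamma (b - 0)) subr0 mulVf// gt_eqF.
by rewrite scale1r mulrN1 scalerN opprD [_ / Gamma b]mulrC addrC.
Qed.

Lemma prod_gamma_ratio_natB (a : R) k n M : (n <= M)%N ->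
  \prod_(k <= i < n) gamma_ratio sigma a ((M - i)%:R / 2) =
  \prod_(k <= i < n) gamma_ratio sigma a ((M%:R - i%:R) / 2).
Proof.
move=> nM; apply: eq_big_nat => i /andP[_ ni].
by rewrite natrB// (leq_trans (ltnW ni)).
Qed.
End gamma_ratio.

(** * The capacity bound *)

Section capacity_bound.
Context {R : realType}.
Variable sigma : R.
Hypothesis sigma0 : sigma != 0.
Local Notation iid := (iid_normal sigma).
Local Notation toC := (real_complex R).

(** [Z] is a Gram determinant of rotated entries. The rotations are fixed, so invariance removes
    them under the integral, and dropping the first row and column leaves an iid matrix of size n -
    1 by M - 1. *)
Lemma perturbed_gram d (T : measurableType d) (P : probability T R) n M
    (X : 'I_n * 'I_M -> T -> R) : iid P X -> (n <= M)%N ->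
  exists Z : T -> R, [/\ measurable_fun setT Z, forall t, 0 <= Z t,
    forall t, let A := \matrix_(k, l) X (k, l) t in
      \det (perturbed A *m ctrmx (perturbed A)) = toC (\det (A *m A^T) + (n * M)%:R * Z t) &
    forall a, 0 < a -> a < 2^-1 ->
      (\int[P]_t laplace_powR a (Z t) =
       (Gamma a * \prod_(1 <= i < n) gamma_ratio sigma a ((M - i)%:R / 2))%:E)%E].
Proof.
case: n X => [|n] X iX; [|case: M X iX => [//|M] X iX].
  (* For n = 0 the coefficient of [Z] is 0; the constant 1 is chosen because its negative moments
     match the empty product. *)
  move=> _; exists (cst 1); split => [|t|t A|a a0 _] //.
    by rewrite !det_mx00 mul0r addr0 rmorph1.
  by rewrite /= probability_integral_cst laplace_powR1// big_geq// mulr1.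
move=> nM; have [p [q [gp gq H]]] := det_perturbed R n M.
pose mx t := \matrix_(k < 1 + n, l < 1 + M) X (k, l) t.
pose dr (A : 'M[R]_(1 + n, 1 + M)) := drsubmx A.
have mdr d' (T' : measurableType d') (A : T' -> 'M[R]_(1 + n, 1 + M)) :
    (forall k l, measurable_fun setT (fun t => A t k l)) ->
    forall k l, measurable_fun setT (fun t => dr (A t) k l).
  by move=> mA k l; rewrite /dr; under eq_fun do rewrite !mxE; exact: mA.
have mA k l : measurable_fun setT (fun t => mx t k l).
  by under eq_fun do rewrite mxE; exact: iX.1.
have mpq : forall k l, measurable_fun setT (fun t => (p^T *m mx t *m q) k l).
  apply: (measurable_mulmx (B := fun=> q)) => //.
  by apply: (measurable_mulmx (A := fun=> p^T)) => // k l; exact: measurable_cst.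
exists (fun t => \det (dr (p^T *m mx t *m q) *m (dr (p^T *m mx t *m q))^T)); split.
- apply: measurable_det; apply: measurable_mulmx; first exact: mdr.
  by move=> k l; under eq_fun do rewrite mxE; exact: mdr.
- by move=> t; exact: det_gram_ge0.
- by move=> t A; rewrite H.
move=> a a0 a2.
pose F (A : 'M[R]_(1 + n, 1 + M)) := laplace_powR a (1 * \det (dr A *m (dr A)^T)).
have mF : mxfunctional F by exact: mxfunctional_laplace_gram.
transitivity (\int[P]_t F (p^T *m mx t *m q))%E.
  by apply: eq_integral => t _; rewrite /F mul1r.
rewrite -(iid_normal_tr_rotation_mul sigma0 gp iX (mxfunctional_mulmxr q mF)).
rewrite -(iid_normal_mul_rotation sigma0 gq iX mF).
pose Xd (z : 'I_n * 'I_M) t := X (lift 0 z.1, lift 0 z.2) t.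
have iXd : iid P Xd.
  by apply: iid_normal_comp iX => -[k l] [k' l'] /= /pair_equal_spec [/lift_inj -> /lift_inj ->].
(* The smaller matrix has one column fewer, so its factor i is the factor i + 1 of the full one;
   hence the product from 1. *)
rewrite big_add1 /= -(iid_normal_laplace_gram sigma0 iXd nM a0 a2).
apply: eq_integral => t _; rewrite /F mul1r.
have -> : dr (mx t) = \matrix_(k, l) Xd (k, l) t.
  by apply/matrixP => k l; rewrite !mxE /Xd; congr (X (_, _) t); apply/val_inj.
by [].
Qed.

Lemma log2_det_perturbed_ge d (T : measurableType d) (P : probability T R) m M
    (X : 'I_m * 'I_M -> T -> R) (c : R) : iid P X -> (m <= M)%N -> 0 <= c ->
  ((log2 (1 + \sum_(1 <= n < m.+1) c ^+ n * 'C(m, n)%:R *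
      \prod_(0 <= k < n) (kdelta k * (n * M)%:R
                        + 2 * sigma ^+ 2 * expR (digamma ((M%:R - k%:R) / 2)))))%:E <=
   \int[P]_t (log2 (complex.Re (\det (1%:M + toC c *:
      (perturbed (\matrix_(k, l) X (k, l) t) *m ctrmx (perturbed (\matrix_(k, l) X (k, l) t)))))))%:E)%E.
Proof.
move=> iX mM c0.
have s2 : 0 < 2 * sigma ^+ 2 by rewrite mulr_gt0// exprn_even_gt0.
pose Phi t : 'M[R]_(m, M) := \matrix_(k, l) X (k, l) t.
pose XS (S : {set 'I_m}) (z : 'I_#|S| * 'I_M) t := X (enum_val z.1, z.2) t.
pose AS (S : {set 'I_m}) t : 'M[R]_(#|S|, M) := \matrix_(k, l) XS S (k, l) t.
have iXS S : iid P (XS S).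
  by apply: iid_normal_comp iX => -[k l] [k' l'] /= /pair_equal_spec [/enum_val_inj -> ->].
have cS (S : {set 'I_m}) : (#|S| <= m)%N by rewrite -[leqRHS]card_ord max_card.
have cSM (S : {set 'I_m}) : (#|S| <= M)%N by exact: leq_trans (cS S) mM.
have [Z HZ] := choice (fun S => perturbed_gram (iXS S) (cSM S)).
(* The two summands of each principal minor are separate terms of the log-sum; the
   empty minor is the constant [1], whence [p = 0] there. *)
pose J := ({set 'I_m} * bool)%type.
pose p (j : J) : R := if j.1 == finset.set0 then 0 else
  c ^+ #|j.1| * (if j.2 then (#|j.1| * M)%:R else 1).
pose Y (j : J) t : R := if j.2 then Z j.1 t else \det (AS j.1 t *m (AS j.1 t)^T).
pose b (i : nat) : R := (M%:R - i%:R) / 2.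
(* The boolean [j.2] is read as the first index: 0 for the full Gram determinant, 1 for the stripped
   one, which lacks the leading chi-square factor. *)
pose l (j : J) : R := \sum_(i <- index_iota j.2 #|j.1|) (ln (2 * sigma ^+ 2) + digamma (b i)).
pose Mo (j : J) (a : R) : R := \prod_(i <- index_iota j.2 #|j.1|) gamma_ratio sigma a (b i).
have p0 j : 0 <= p j.
  by rewrite /p; case: ifP => // _; rewrite mulr_ge0 ?exprn_ge0//; case: j.2.
have b0 (j : J) i : i \in index_iota j.2 #|j.1| -> 0 < b i.
  rewrite mem_index_iota => /andP[_ iS]; rewrite divr_gt0// subr_gt0 ltr_nat.
  exact: leq_trans iS (cSM _).
have mAS S : forall k l, measurable_fun setT (fun t => AS S t k l).
  by move=> k l'; under eq_fun do rewrite mxE; exact: (iXS S).1.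
have mY j : measurable_fun setT (Y j).
  rewrite /Y; case: j => S [] /=; first by have [] := HZ S.
  apply: measurable_det; apply: measurable_mulmx => // k l'.
  by under eq_fun do rewrite mxE; exact: mAS.
have Y0 j t : 0 <= Y j t.
  by rewrite /Y; case: j => S [] /=; [have [_ + _ _] := HZ S; exact|exact: det_gram_ge0].
have EY j a : 0 < a -> a < 2^-1 ->
    (\int[P]_t laplace_powR a (Y j t) = (Gamma a * Mo j a)%:E)%E.
  move=> a0 a2; rewrite /Y /Mo; case: j => S [] /=.
    by have [_ _ _ /(_ _ a0 a2) ->] := HZ S; rewrite prod_gamma_ratio_natB.
  by rewrite (iid_normal_laplace_gram sigma0 (iXS S) (cSM S) a0 a2) prod_gamma_ratio_natB.
have M0 j : Mo j 0 = 1.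
  by rewrite /Mo big1_seq// => i /andP[_ ij]; rewrite gamma_ratio0//; exact: b0 ij.
have dM j : is_derive (0 : R) 1 (Mo j) (- l j).
  apply: is_derive_prod1 => i ij; first by rewrite gamma_ratio0//; exact: b0 ij.
  by apply: is_derive_gamma_ratio => //; exact: b0 ij.
have half0 : (0 : R) < 2^-1 by rewrite invr_gt0.
have main := le_integral_ln_1Dsum half0 p0 mY Y0 EY M0 dM.
have sumJ (F : J -> R) : \sum_j F j = \sum_(S : {set 'I_m}) (F (S, true) + F (S, false)).
  transitivity (\sum_(j : J) F (j.1, j.2)); first by apply: eq_bigr => -[].
  rewrite -(pair_bigA _ (fun S b => F (S, b))) /=; apply: eq_bigr => S _.
  by rewrite big_bool.
pose q (i : nat) : R := 2 * sigma ^+ 2 * expR (digamma (b i)).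
have el j : expR (l j) = \prod_(i <- index_iota j.2 #|j.1|) q i.
  rewrite /l expR_sum; apply: eq_bigr => i _.
  by rewrite expRD lnK// posrE.
have pf S : p (S, true) * expR (l (S, true)) + p (S, false) * expR (l (S, false)) =
    if #|S| == 0%N then 0 else
    c ^+ #|S| * \prod_(0 <= k < #|S|) (kdelta k * (#|S| * M)%:R + q k).
  rewrite !el /p /= cards_eq0; case: ifPn => [_|S0]; first by rewrite !mul0r addr0.
  rewrite prod_kdelta; last by rewrite card_gt0.
  by rewrite mulr1 mulrDr mulrA.
have lhsE : 1 + \sum_j p j * expR (l j) =
    1 + \sum_(1 <= n < m.+1) c ^+ n * 'C(m, n)%:R *
      \prod_(0 <= k < n) (kdelta k * (n * M)%:R + q k).
  by rewrite -sum_set_weighted sumJ; congr (1 + _); apply: eq_bigr => S _; exact: pf.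
pose V t := 1 + \sum_j p j * Y j t.
have detE t : \det (1%:M + toC c *: (perturbed (Phi t) *m ctrmx (perturbed (Phi t)))) = toC (V t).
  rewrite det_1D_perturbed.
  have E (S : {set 'I_m}) : toC c ^+ #|S| * \det (perturbed (rowsub (@enum_val _ (mem S)) (Phi t)) *m
     ctrmx (perturbed (rowsub (@enum_val _ (mem S)) (Phi t)))) =
     toC (c ^+ #|S| * (\det (AS S t *m (AS S t)^T) + (#|S| * M)%:R * Z S t)).
    have -> : rowsub (@enum_val _ (mem S)) (Phi t) = AS S t.
      by apply/matrixP => k l'; rewrite !mxE.
    have [_ _ /(_ t) H _] := HZ S; rewrite /= -/(AS S t) in H.
    by rewrite H [RHS]rmorphM rmorphXn.
  under eq_bigr do rewrite E.
  rewrite -rmorph_sum /V; congr toC; rewrite sumJ.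
  rewrite (bigD1 finset.set0)//= [in RHS](bigD1 finset.set0)//=.
  rewrite /p /= eqxx !mul0r addr0 add0r; congr (_ + _).
    have gram0 n (A : 'M[R]_(n, M)) : n = 0%N -> \det (A *m A^T) = 1.
      by move=> n0; subst n; rewrite det_mx00.
    by rewrite gram0 ?cards0// expr0 mul1r mul0n mul0r addr0.
  apply: eq_bigr => S S0; rewrite (negbTE S0) /Y /=; ring.
have V1 t : 1 <= V t by rewrite /V lerDl sumr_ge0// => j _; rewrite mulr_ge0.
have mV : measurable_fun setT V.
  apply: measurable_funD => //; apply: measurable_sum => j; exact: measurable_funM.
have mlnV : measurable_fun setT (fun t => (ln (V t))%:E).
  by apply/measurable_EFinP; exact: measurableT_comp.
have lnV0 t : setT t -> (0 <= (ln (V t))%:E)%E by move=> _; rewrite lee_fin ln_ge0.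
have ln20 : 0 < ln 2 :> R by rewrite ln_gt0// ltr1n.
have ln2V : (0 <= ((ln 2)^-1 : R)%:E)%E by rewrite lee_fin invr_ge0 ltW.
rewrite -lhsE.
have -> : (\int[P]_t (log2 (complex.Re (\det (1%:M + toC c *:
      (perturbed (\matrix_(k, l) X (k, l) t) *m ctrmx (perturbed (\matrix_(k, l) X (k, l) t)))))))%:E =
    \int[P]_t ((ln (V t))%:E * ((ln 2)^-1)%:E))%E.
  by apply: eq_integral => t _; rewrite detE.
rewrite ge0_integralZr// /log2 EFinM.
exact: lee_wpmul2r.
Qed.
End capacity_bound.

Theorem theorem7 (R : realType) (d : measure_display) (T : measurableType d)
  (P : probability T R) (MR MT : nat) (rho sigma2 : R)
  (g : 'cV[R[i]]_MR) (h : 'cV[R[i]]_MT)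
  (Phi : 'I_MR * 'I_MT -> T -> R) :
  (0 < MR)%N -> (0 < MT)%N -> 0 < rho -> 0 < sigma2 ->
  (forall k, `|g k 0| = 1) -> (forall l, `|h l 0| = 1) ->
  (forall kl, measurable_fun setT (Phi kl)) ->
  mutually_independent P Phi ->
  (forall kl (A : set R), measurable A ->
     P (Phi kl @^-1` A) = normal_prob 0 (Num.sqrt sigma2) A) ->
  let Chat := (\int[P]_w (capa rho g h (\matrix_(k, l) Phi (k, l) w))%:E)%E in
  ((MR <= MT)%N -> ((capa_lb rho sigma2 MT MR MT)%:E <= Chat)%E) /\
  ((MT < MR)%N -> ((capa_lb rho sigma2 MT MT MR)%:E <= Chat)%E).
Proof.
move=> MR0 MT0 rho0 s20 g1 h1 mPhi indep normalPhi /=.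
have sn0 : Num.sqrt sigma2 != 0 by rewrite gt_eqF// sqrtr_gt0.
have s2E : Num.sqrt sigma2 ^+ 2 = sigma2 by rewrite sqr_sqrtr// ltW.
have c0 : 0 <= rho / MT%:R by apply: divr_ge0; [exact: ltW|exact: ler0n].
have iPhi : iid_normal (Num.sqrt sigma2) P Phi.
  split=> // B mB; apply: etrans (indep B mB) _.
  by apply: eq_bigr => k _; exact: normalPhi.
split => MRT; rewrite /capa_lb.
  have := log2_det_perturbed_ge sn0 iPhi MRT c0; rewrite s2E => /le_trans; apply.
  rewrite le_eqVlt; apply/orP; left; apply/eqP; apply: eq_integral => t _.
  by rewrite /capa det_Hhat.
(* Transposing exchanges the two dimensions in the determinant but leaves the scaling [rho / MT%:R]
   as it is. *)
have inj : injective (fun z : 'I_MT * 'I_MR => (z.2, z.1)) by move=> [? ?] [? ?] [-> ->].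
have iPhiT := iid_normal_comp inj iPhi.
have := log2_det_perturbed_ge sn0 iPhiT (ltnW MRT) c0; rewrite s2E => /le_trans; apply.
rewrite le_eqVlt; apply/orP; left; apply/eqP; apply: eq_integral => t _.
rewrite /capa det_Hhat// det_perturbed_tr.
have -> : (\matrix_(k, l) Phi (k, l) t)^T = \matrix_(k, l) Phi (l, k) t.
  by apply/matrixP => k l; rewrite !mxE.
by [].
Qed.
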